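(* Fix $\beta\ge1$. Generically in the pair of distributions $(F_A,F_B)$, in any core outcome under EPSW firms completely segregate, that is, one firm hires almost all $A$-group workers and the other hires almost all $B$-group workers: for some $i\in\{1,2\}$, $f_A^i(v)=f_A(v)$ for almost all $v\in[0,1]$ and $f_B^{-i}(v)=f_B(v)$ for almost all $v\in[0,1]$ (where $-i$ denotes the other firm).
   Context: Labor market. There are two firms, 1 and 2, and a continuum of workers. A worker has a type $(g,v)\in\{A,B\}\times[0,1]$ ($g$ = group, $v$ = productivity). There is a measure $\beta\ge 1$ of $A$-group workers and measure $1$ of $B$-group workers. Productivities in group $g$ are distributed with cdf $F_g$ on $[0,1]$, absolutely continuous with density $f_g$ satisfying $0<\inf_{v\in[0,1]} f_g(v)\le \sup_{v\in[0,1]} f_g(v)<\infty$ (regularity conditions). A (labor) market is a tuple $(\beta,F_A,F_B)$. Genericity. Consider the space of distributions satisfying the regularity conditions above, endowed with the weak-$^*$ topology (i.e. the topology of weak convergence of probability measures). A property holds generically if it holds on an open and dense subset, with respect to the product topology, of the product set of pairs $(F_A,F_B)$ of such distributions. Outcomes under EPSW. An outcome for firm $i$ is $O_i=\{(f_g^i(v),w_i^g(v))\}_{v\in[0,1],\,g=A,B}$ with $f_g^i(v)\in[0,f_g(v)]$ (density of type-$(g,v)$ workers hired by $i$) and $w_i^g(v)\in[0,\infty)$ (wage paid by $i$ to them), where $w_i^g(v)=0$ by convention whenever $f_g^i(v)=0$; all these functions are measurable in $v$. Under EPSW (''equal pay for similar work'') an outcome for firm $i$ must in addition satisfy: there exist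 no group $g$ (with $-g$ the other group) and no sets $V_g,V_{-g}\subset[0,1]$ of positive Lebesgue measure such that $f_g^i(v)>0$ for all $v\in V_g$, $f_{-g}^i(v)>0$ for all $v\in V_{-g}$, and $\inf_{v\in V_{-g}}w_i^{-g}(v)>\sup_{v\in V_g}w_i^g(v)$. An outcome is a pair $O=(O_1,O_2)$ of outcomes for the firms with $f_g^1(v)+f_g^2(v)\le f_g(v)$ for all $v,g$. Firm $i$'s profit is $$\pi_i^{O}=\pi_i^{O_i}=\beta\int_0^1[v-w_i^A(v)]f_A^i(v)\,dv+\int_0^1[v-w_i^B(v)]f_B^i(v)\,dv.$$ Blocking and core. An outcome $O$ is blocked by firm $j$ via an outcome for $j$ (satisfying the EPSW restriction), $\tilde O_j=\{(\tilde f_g^j(v),\tilde w_j^g(v))\}_{v,g}$, if $\pi_j^{\tilde O_j}>\pi_j^{O_j}$ and, for each $g\in\{A,B\}$ and almost all $v\in[0,1]$, at least one of the following holds ($-j$ denotes the other firm): (1) $\tilde w_j^g(v)\ge w_j^g(v)$ and $\tilde w_j^g(v)>w_{-j}^g(v)$; (2) $\tilde w_j^g(v)\ge w_j^g(v)$ and $\tilde f_g^j(v)+f_g^{-j}(v)\le f_g(v)$; (3) $\tilde w_j^g(v)>w_{-j}^g(v)$ and $\tilde f_g^j(v)+f_g^j(v)\le f_g(v)$; (4) $\tilde f_g^j(v)+f_g^j(v)+f_g^{-j}(v)\le f_g(v)$. A core outcome under EPSW is an outcome (satisfying the EPSW restriction) that is not blocked by any firm via any outcome for that firm satisfying the EPSW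 restriction. ''Almost all'' is with respect to Lebesgue measure. *)

(* Defs.v *)
From HB Require Import structures.
From mathcomp Require Import all_boot all_order all_algebra.
From mathcomp Require Import all_classical all_reals all_analysis.

Set Implicit Arguments.
Unset Strict Implicit.
Unset Printing Implicit Defensive.

Import Order.TTheory GRing.Theory Num.Theory.
Import numFieldTopology.Exports numFieldNormedType.Exports.

Local Open Scope classical_set_scope.
Local Open Scope ring_scope.

Variant worker_group := GroupA | GroupB.
Variant firm := Firm1 | Firm2.

Definition other_group (g : worker_group) : worker_group :=
  if g is GroupA then GroupB else GroupA.
Definition other_firm (i : firm) : firm :=
  if i is Firm1 then Firm2 else Firm1.

(* Densities, hiring densities and wages are total functions on R; only their
   values on [0, 1] matter. *)

Definition regular_density (R : realType)
    (P : probability (measurableTypeR R) R) (f : R -> R) : Prop :=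
  [/\ measurable_fun (`[0, 1] : set R) f,
      (0 < ereal_inf [set (f v)%:E | v in `[0%R, 1%R]])%E,
      (ereal_sup [set (f v)%:E | v in `[0%R, 1%R]] < +oo)%E &
      forall X : set (measurableTypeR R), measurable X ->
        P X = (\int[lebesgue_measure]_(v in X `&` `[0%R, 1%R]) (f v)%:E)%E ].

(* A distribution is its law, so that densities equal almost everywhere give
   the same distribution (the law and its cdf determine each other). *)
Record regular_distribution (R : realType) := RegularDistribution {
  law : probability (measurableTypeR R) R ;
  law_regular : exists f : R -> R, regular_density law f }.

Definition test_function (R : realType) :=
  {phi : R -> R | {within `[0, 1], continuous phi}}.

Definition expectations (R : realType) (F : regular_distribution R) :
    {ptws test_function R -> R} :=
  fun phi => (\int[law F]_(v in `[0, 1]) sval phi v)%R.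

HB.instance Definition _ (R : realType) :=
  gen_eqMixin (regular_distribution R).
HB.instance Definition _ (R : realType) :=
  gen_choiceMixin (regular_distribution R).

(* Weak-* topology: the coarsest one making F |-> \int phi dF continuous for
   every continuous phi on [0, 1]. *)
HB.instance Definition _ (R : realType) :=
  Topological.copy (regular_distribution R)
    (initial_topology (@expectations R)).

Definition generically (R : realType)
    (Q : regular_distribution R -> regular_distribution R -> Prop) : Prop :=
  exists U : set (regular_distribution R * regular_distribution R),
    [/\ open U, dense U & forall FA FB, U (FA, FB) -> Q FA FB].

Record firm_outcome (R : realType) := FirmOutcome {
  hire : worker_group -> R -> R ;
  wage : worker_group -> R -> R }.

Definition feasible (R : realType) (f : worker_group -> R -> R)
    (Oi : firm_outcome R) : Prop :=
  forall g,
    [/\ measurable_fun (`[0, 1] : set R) (hire Oi g),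
        measurable_fun (`[0, 1] : set R) (wage Oi g) &
        forall v, v \in `[0, 1] ->
          [/\ 0 <= hire Oi g v <= f g v,
              0 <= wage Oi g v &
              hire Oi g v = 0 -> wage Oi g v = 0 ] ].

Definition epsw (R : realType) (Oi : firm_outcome R) : Prop :=
  ~ exists (g : worker_group) (V V' : set R),
      [/\ [/\ measurable V, V `<=` `[0, 1] & (0 < lebesgue_measure V)%E],
          [/\ measurable V', V' `<=` `[0, 1] & (0 < lebesgue_measure V')%E],
          forall v, V v -> 0 < hire Oi g v,
          forall v, V' v -> 0 < hire Oi (other_group g) v &
          (ereal_sup [set (wage Oi g v)%:E | v in V] <
           ereal_inf [set (wage Oi (other_group g) v)%:E | v in V'])%E ].

Definition epsw_firm_outcome (R : realType) (f : worker_group -> R -> R)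
    (Oi : firm_outcome R) : Prop :=
  feasible f Oi /\ epsw Oi.

Definition epsw_outcome (R : realType) (f : worker_group -> R -> R)
    (O : firm -> firm_outcome R) : Prop :=
  (forall i, epsw_firm_outcome f (O i)) /\
  forall g v, v \in `[0, 1] ->
    hire (O Firm1) g v + hire (O Firm2) g v <= f g v.

(* Wages may be unbounded, so a profit can be -oo; the positive parts of the
   integrands are bounded, hence it is always well defined and < +oo. *)
Definition profit (R : realType) (beta : R) (Oi : firm_outcome R) : \bar R :=
  (beta%:E *
     \int[lebesgue_measure]_(v in `[0%R, 1%R])
        ((v - wage Oi GroupA v) * hire Oi GroupA v)%:E
   + \int[lebesgue_measure]_(v in `[0%R, 1%R])
        ((v - wage Oi GroupB v) * hire Oi GroupB v)%:E)%E.

Definition blocks (R : realType) (beta : R) (f : worker_group -> R -> R)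
    (O : firm -> firm_outcome R) (j : firm) (D : firm_outcome R) : Prop :=
  let Oj := O j in let Ok := O (other_firm j) in
  [/\ epsw_firm_outcome f D,
      (profit beta Oj < profit beta D)%E &
      forall g, {ae lebesgue_measure, forall v : R, v \in `[0, 1] ->
        [\/ wage D g v >= wage Oj g v /\ wage D g v > wage Ok g v,
            wage D g v >= wage Oj g v /\ hire D g v + hire Ok g v <= f g v,
            wage D g v > wage Ok g v /\ hire D g v + hire Oj g v <= f g v |
            hire D g v + hire Oj g v + hire Ok g v <= f g v ]} ].

Definition core_outcome (R : realType) (beta : R) (f : worker_group -> R -> R)
    (O : firm -> firm_outcome R) : Prop :=
  epsw_outcome f O /\ ~ exists j D, blocks beta f O j D.

Definition hires_almost_all (R : realType) (f : worker_group -> R -> R)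
    (Oi : firm_outcome R) (g : worker_group) : Prop :=
  {ae lebesgue_measure, forall v : R, v \in `[0, 1] -> hire Oi g v = f g v}.

Definition completely_segregated (R : realType) (f : worker_group -> R -> R)
    (O : firm -> firm_outcome R) : Prop :=
  exists i, hires_almost_all f (O i) GroupA /\
            hires_almost_all f (O (other_firm i)) GroupB.

(* Main.v *)
(* A firm that hires both groups must, by EPSW, pay all its workers one common
   wage.  In a core outcome either firm may instead give up one group and poach
   every worker of the other group at an arbitrarily small raise, so each
   firm's profit is at least the total profit that both firms make on either
   group.  Summing over firms and over groups gives the same total, hence all
   these quantities coincide and there is full employment.  If the firms do not
   segregate, some firm is integrated; then its rival must be integrated too,
   one firm pays 0 and hires exactly the workers below some w, and the other
   pays w and hires exactly the workers above w.  The equal profits become two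
   equations in the single unknown w,
     beta * E_A[v; v <= w] = E_B[(v - w)^+],   E_B[v; v <= w] = beta * E_A[(v - w)^+].
   Their left-hand sides increase and their right-hand sides decrease in w, so
   they have no common root as soon as, at a single w, they fail strictly in
   opposite directions: this is an open condition.  It is dense because, at a root w
   of the first equation, mixing F_A or F_B with a law concentrated near 0
   strictly lowers both expectations under that law. *)

From HB Require Import structures.
Require Import Defs.
From mathcomp Require Import all_boot all_order all_algebra.
From mathcomp Require Import all_classical all_reals all_analysis.
From mathcomp Require Import measurable_realfun ring lra.

Set Implicit Arguments.
Unset Strict Implicit.
Unset Printing Implicit Defensive.

Import Order.TTheory GRing.Theory Num.Theory.
Import numFieldTopology.Exports numFieldNormedType.Exports.

Local Open Scope classical_set_scope.
Local Open Scope ring_scope.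

(** * Integration over the unit interval *)

Definition unit_integrable (R : realType) (h : R -> R) : Prop :=
  lebesgue_measure.-integrable (`[0, 1] : set R) (EFin \o h).

Definition unit_integral (R : realType) (h : R -> R) : R :=
  (\int[lebesgue_measure]_(v in `[0, 1]) h v)%R.

Definition ae_unit (R : realType) (P : R -> Prop) : Prop :=
  {ae lebesgue_measure, forall v : R, v \in `[0, 1] -> P v}.

#[global] Instance ae_lebesgue_filter (R : realType) :
  Filter (almost_everywhere (@lebesgue_measure R)).
Proof. exact: ae_filter_ringOfSetsType. Qed.

Section UnitIntegral.
Context (R : realType).
Implicit Types (h k : R -> R) (P Q S : R -> Prop).

Let mI : measurable (`[0, 1] : set R).
Proof. exact: measurable_itv. Qed.

Lemma ae_unitW P : (forall v, v \in `[0, 1] -> P v) -> ae_unit P.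
Proof. by move=> H; apply: aeW. Qed.

Lemma ae_unitS P Q : (forall v, v \in `[0, 1] -> P v -> Q v) -> ae_unit P -> ae_unit Q.
Proof. by move=> PQ; rewrite /ae_unit; apply: filterS => v Pv vI; apply: PQ => //; exact: Pv. Qed.

Lemma ae_unitI P Q : ae_unit P -> ae_unit Q -> ae_unit (fun v => P v /\ Q v).
Proof. by rewrite /ae_unit; apply: filterS2 => v Pv Qv vI; split; [exact: Pv|exact: Qv]. Qed.

Lemma ae_unitS2 P Q S : (forall v, v \in `[0, 1] -> P v -> Q v -> S v) ->
  ae_unit P -> ae_unit Q -> ae_unit S.
Proof. by move=> H p q; apply: ae_unitS (ae_unitI p q) => v vI []; exact: H. Qed.

Lemma ae_unitS3 P Q S P' : (forall v, v \in `[0, 1] -> P v -> Q v -> S v -> P' v) ->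
  ae_unit P -> ae_unit Q -> ae_unit S -> ae_unit P'.
Proof.
by move=> H p q s; apply: ae_unitS2 (ae_unitI p q) s => v vI []; exact: H.
Qed.

Lemma ae_unit_neq (a : R) : ae_unit (fun v => v != a).
Proof.
exists [set a]; split => //; first exact: lebesgue_measure_set1.
by move=> v /= /not_implyP[_] /negP; rewrite negbK => /eqP.
Qed.

Lemma unit_integrable_measurable h : unit_integrable h ->
  measurable_fun (`[0, 1] : set R) h.
Proof. by move=> /measurable_int /measurable_EFinP. Qed.

Lemma unit_integrable_ae_bounded h (C : R) : measurable_fun (`[0, 1] : set R) h ->
  ae_unit (fun v => `|h v| <= C) -> unit_integrable h.
Proof.
move=> mh hC; apply/integrableP; split; first exact/measurable_EFinP.
apply: (@le_lt_trans _ _ (\int[lebesgue_measure]_(v in `[0%R, 1%R]) (`|C|%:E))%E).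
  apply: ae_ge0_le_integral => //=.
  - by apply/measurable_EFinP; exact: measurableT_comp.
  - move: hC; rewrite /ae_unit; apply: filterS => v hv vI; rewrite lee_fin.
    by rewrite (le_trans (hv vI))// ler_norm.
by rewrite integral_cst//= lebesgue_measure_itv/= lte_fin ltr01 oppr0 adde0 mule1 ltry.
Qed.

Lemma unit_integrableD h k : unit_integrable h -> unit_integrable k ->
  unit_integrable (fun v => h v + k v).
Proof. by move=> hi ki; apply: eq_integrable (integrableD _ hi ki). Qed.

Lemma unit_integrableB h k : unit_integrable h -> unit_integrable k ->
  unit_integrable (fun v => h v - k v).
Proof. by move=> hi ki; apply: eq_integrable (integrableB _ hi ki). Qed.

Lemma unit_integrableZ h (c : R) : unit_integrable h ->
  unit_integrable (fun v => c * h v).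
Proof. by move=> hi; apply: eq_integrable (integrableZl _ c hi). Qed.

Lemma unit_integralD h k : unit_integrable h -> unit_integrable k ->
  unit_integral (fun v => h v + k v) = unit_integral h + unit_integral k.
Proof. by move=> hi ki; exact: RintegralD. Qed.

Lemma unit_integralB h k : unit_integrable h -> unit_integrable k ->
  unit_integral (fun v => h v - k v) = unit_integral h - unit_integral k.
Proof. by move=> hi ki; exact: RintegralB. Qed.

Lemma unit_integralZ h (c : R) : unit_integrable h ->
  unit_integral (fun v => c * h v) = c * unit_integral h.
Proof. by move=> hi; exact: RintegralZl. Qed.

Lemma unit_integralE h : unit_integrable h ->
  (\int[lebesgue_measure]_(v in `[0%R, 1%R]) (h v)%:E = (unit_integral h)%:E)%E.
Proof. by move=> hi; rewrite fineK//; exact: integrable_fin_num. Qed.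

Lemma unit_integral_eq h k : (forall v, v \in `[0, 1] -> h v = k v) ->
  unit_integral h = unit_integral k.
Proof. by move=> hk; apply: eq_Rintegral => v /set_mem; exact: hk. Qed.

Lemma unit_integral_eq_ae h k : measurable_fun (`[0, 1] : set R) h ->
  measurable_fun (`[0, 1] : set R) k -> ae_unit (fun v => h v = k v) ->
  unit_integral h = unit_integral k.
Proof.
move=> mh mk hk; congr fine; apply: ae_eq_integral => //; try exact/measurable_EFinP.
by move: hk; rewrite /ae_unit; apply: filterS => v hv vI; congr EFin; exact: hv.
Qed.

Let unit_integral_abs h : unit_integrable h -> ae_unit (fun v => 0 <= h v) ->
  (\int[lebesgue_measure]_(v in `[0%R, 1%R]) `|(h v)%:E| = (unit_integral h)%:E)%E.
Proof.
move=> hi h0; rewrite -unit_integralE//; have mh := unit_integrable_measurable hi.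
apply: ae_eq_integral => //.
- by apply/measurable_EFinP; exact: measurableT_comp.
- exact/measurable_EFinP.
- by move: h0; rewrite /ae_unit; apply: filterS => v hv vI; rewrite gee0_abs// lee_fin; exact: hv.
Qed.

Lemma unit_integral_ge0 h : unit_integrable h -> ae_unit (fun v => 0 <= h v) ->
  0 <= unit_integral h.
Proof.
by move=> hi h0; rewrite -lee_fin -unit_integral_abs//; exact: integral_ge0.
Qed.

Lemma unit_integral_eq0 h : unit_integrable h -> ae_unit (fun v => 0 <= h v) ->
  unit_integral h <= 0 -> ae_unit (fun v => h v = 0).
Proof.
move=> hi h0 H; have J0 : unit_integral h = 0.
  by apply/eqP; rewrite eq_le H unit_integral_ge0.
have := unit_integral_abs hi h0; rewrite J0 => /ae_eq_integral_abs; case=> //.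
  by apply/measurable_EFinP; exact: unit_integrable_measurable.
move=> N [? ? sub]; exists N; split=> //; apply: subset_trans sub => v /= Nv Hv.
by apply: Nv => vI; apply: EFin_inj; exact: Hv.
Qed.

Lemma le_unit_integral h k : unit_integrable h -> unit_integrable k ->
  ae_unit (fun v => h v <= k v) -> unit_integral h <= unit_integral k.
Proof.
move=> hi ki hk; rewrite -subr_ge0 -unit_integralB//.
apply: unit_integral_ge0; first exact: unit_integrableB.
by apply: ae_unitS hk => v _; rewrite subr_ge0.
Qed.

(** The difference [k - h] is nonnegative with integral at most 0, so it vanishes almost everywhere.
    This is how equalities of profits become statements about almost every type. *)
Lemma unit_integral_eq_le h k : unit_integrable h -> unit_integrable k ->
  ae_unit (fun v => h v <= k v) -> unit_integral k <= unit_integral h ->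
  ae_unit (fun v => h v = k v).
Proof.
move=> hi ki hk kh.
have : ae_unit (fun v => k v - h v = 0).
  apply: unit_integral_eq0; first exact: unit_integrableB.
    by apply: ae_unitS hk => v _; rewrite subr_ge0.
  by rewrite unit_integralB// subr_le0.
by apply: ae_unitS => v _ /eqP; rewrite subr_eq0 => /eqP.
Qed.

Lemma unit_integral_cst (c : R) : unit_integral (fun=> c) = c.
Proof.
rewrite /unit_integral Rintegral_cst//= lebesgue_measure_itv/= lte_fin ltr01.
by rewrite oppr0 adde0 mulr1.
Qed.

Lemma unit_integrable_cst (c : R) : unit_integrable (fun=> c).
Proof. by apply: (@unit_integrable_ae_bounded _ `|c|) => //; exact: ae_unitW. Qed.

(** The interval from [a] to the smaller of [b] and 1 has positive length and cannot lie in a null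
    set; almost-everywhere facts can thus be tested at a type in a chosen range. *)
Lemma ae_unit_exists P (a b : R) : 0 <= a -> a < b -> a < 1 -> ae_unit P ->
  exists2 v, v \in `[0, 1] & a < v < b /\ P v.
Proof.
move=> a0 ab a1 [N [mN N0 sub]]; apply: contrapT => H.
pose c := Num.min b 1.
have ac : a < c by rewrite /c lt_min ab a1.
have : (lebesgue_measure (`]a, c[ : set R) <= lebesgue_measure N)%E.
  apply: le_measure; rewrite ?inE//= => v /=.
  rewrite in_itv/= /c lt_min => /andP[av /andP[vb v1]]; apply: sub => /= Pv.
  have vI : v \in `[0, 1] by rewrite in_itv/= (ltW v1) (le_trans a0 (ltW av)).
  by apply: H; exists v => //; rewrite av vb; split=> //; exact: Pv.
by rewrite N0 lebesgue_measure_itv/= lte_fin ac -EFinB lee_fin leNgt subr_gt0 ac.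
Qed.

End UnitIntegral.

Section MeasurableUnit.
Context (R : realType).

Lemma measurable_unit_if (b : R -> bool) (h k : R -> R) :
  measurable_fun (`[0, 1] : set R) b -> measurable_fun (`[0, 1] : set R) h ->
  measurable_fun (`[0, 1] : set R) k ->
  measurable_fun (`[0, 1] : set R) (fun v => if b v then h v else k v).
Proof.
move=> mb mh mk; apply: measurable_fun_if => //.
  by apply: measurable_funS mh => //; exact: subIsetl.
by apply: measurable_funS mk => //; exact: subIsetl.
Qed.

End MeasurableUnit.

Ltac measurability :=
  repeat first
    [ assumption
    | match goal with H : forall g, measurable_fun _ _ |- _ => exact: H end
    | exact: measurable_cst
    | exact: measurable_id
    | apply: measurable_unit_if
    | apply: measurable_fun_ltr
    | apply: measurable_fun_ler
    | apply: measurable_fun_eqr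
    | apply: measurable_and
    | apply: measurable_funB
    | apply: measurable_funN
    | apply: measurable_funD
    | apply: measurable_funM
    | apply: measurable_maxr
    | apply: measurable_minr ].

(** * Value of a group above and below a threshold wage *)

(** Profit, per unit of mass of a group, from hiring every type above [w] at wage [w]. *)
Definition surplus (R : realType) (h : R -> R) (w : R) : R :=
  unit_integral (fun v => Num.max (v - w) 0 * h v).

(** Profit, per unit of mass of a group, from hiring every type up to [w] at wage 0. *)
Definition low_value (R : realType) (h : R -> R) (w : R) : R :=
  unit_integral (fun v => (if v <= w then v else 0) * h v).

Section Values.
Context (R : realType) (f : R -> R) (C : R).
Hypothesis mf : measurable_fun (`[0, 1] : set R) f.
Hypothesis f_bounds : forall v, v \in `[0, 1] -> 0 < f v <= C.
Implicit Types (v w : R).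

Let f_gt0 v : v \in `[0, 1] -> 0 < f v.
Proof. by move=> /f_bounds /andP[]. Qed.

Let f_le v : v \in `[0, 1] -> f v <= C.
Proof. by move=> /f_bounds /andP[]. Qed.

Let C_ge0 : 0 <= C.
Proof.
have I0 : (0 : R) \in `[0, 1] by rewrite in_itv/= lexx ler01.
by rewrite ltW// (lt_le_trans (f_gt0 I0)) ?f_le.
Qed.

Lemma unit_integrable_weighted (h : R -> R) (M : R) :
  measurable_fun (`[0, 1] : set R) h -> (forall v, v \in `[0, 1] -> `|h v| <= M) ->
  unit_integrable (fun v => h v * f v).
Proof.
move=> mh hM; apply: (@unit_integrable_ae_bounded _ _ (M * C)); first exact: measurable_funM.
apply: ae_unitW => v vI; have := f_gt0 vI => f0.
by rewrite normrM ler_pM ?hM// gtr0_norm// f_le.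
Qed.

Lemma unit_integrable_surplus_density w :
  unit_integrable (fun v => Num.max (v - w) 0 * f v).
Proof.
apply: (@unit_integrable_weighted _ (1 + `|w|)); first by measurability.
move=> v; rewrite in_itv/= => /andP[v0 v1]; have := ler_norm (- w); rewrite normrN => nw.
by rewrite ger0_norm ?le_max ?lexx ?orbT// ge_max addr_ge0//= andbT; lra.
Qed.

Lemma unit_integrable_low_value w : unit_integrable (fun v => (if v <= w then v else 0) * f v).
Proof.
apply: (@unit_integrable_weighted _ 1); first by measurability.
by move=> v; rewrite in_itv/= => /andP[v0 v1]; case: ifP; rewrite ?normr0// ger0_norm.
Qed.

Lemma unit_integral_indicator_le (a b : R) : a <= b ->
  unit_integral (fun v : R => if a < v <= b then 1 else 0) <= b - a.
Proof.
move=> ab; rewrite /unit_integral /Rintegral.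
rewrite (_ : (\int[_]_(v in _) _)%E = lebesgue_measure (`]a, b] `&` `[0%R, 1%R])).
  rewrite -lee_fin fineK.
    have -> : ((b - a)%:E = lebesgue_measure (`]a, b]%classic : set R))%E.
      rewrite lebesgue_measure_itv/= lte_fin -EFinB; case: ltP => // ba.
      by have -> : b = a; [apply/eqP; rewrite eq_le ba ab|rewrite subrr].
    apply: le_measure; rewrite ?inE;
      [by apply: measurableI; exact: measurable_itv|exact: measurable_itv|exact: subIsetl].
  have : (lebesgue_measure (`]a, b] `&` `[0%R, 1%R] : set R) <=
      lebesgue_measure (`[0%R, 1%R]%classic : set R))%E.
    apply: le_measure; rewrite ?inE;
      [by apply: measurableI; exact: measurable_itv|exact: measurable_itv|exact: subIsetr].
  rewrite lebesgue_measure_itv/= lte_fin ltr01 oppr0 adde0 => H.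
  by rewrite ge0_fin_numE ?measure_ge0// (le_lt_trans H)// ltry.
rewrite -integral_indic//.
  by apply: eq_integral => v _; rewrite indicE; congr EFin; rewrite mem_setE in_itv/=; case: ifP.
Qed.

Lemma unit_integrable_indicator (a b : R) :
  unit_integrable (fun v : R => if a < v <= b then 1 else 0).
Proof.
apply: (@unit_integrable_ae_bounded _ _ 1).
  by apply: measurable_unit_if; measurability.
by apply: ae_unitW => v _; case: ifP => _; rewrite ?normr1// normr0.
Qed.

Lemma unit_integral_near_indicator_le (h : R -> R) (a b : R) : a <= b ->
  unit_integrable h ->
  (forall v, v \in `[0, 1] -> h v <= C * (if a < v <= b then 1 else 0)) ->
  unit_integral h <= C * (b - a).
Proof.
move=> ab hi hle; apply: (@le_trans _ _ (C * unit_integral (fun v => if a < v <= b then 1 else 0))).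
  rewrite -unit_integralZ; last exact: unit_integrable_indicator.
  apply: le_unit_integral => //; first by apply: unit_integrableZ; exact: unit_integrable_indicator.
  exact: ae_unitW.
by rewrite ler_wpM2l// unit_integral_indicator_le.
Qed.

Lemma le_low_value w w' : w <= w' -> low_value f w <= low_value f w'.
Proof.
move=> ww'; apply: le_unit_integral; [exact: unit_integrable_low_value..|].
apply: ae_unitW => v vI; have f0 := f_gt0 vI; move: vI; rewrite in_itv/= => /andP[v0 v1].
rewrite ler_pM2r//; case: (leP v w) => vw; first by rewrite (le_trans vw ww').
by case: ifP.
Qed.

Lemma ge_surplus w w' : w <= w' -> surplus f w' <= surplus f w.
Proof.
move=> ww'; apply: le_unit_integral; [exact: unit_integrable_surplus_density..|].
apply: ae_unitW => v vI; rewrite ler_pM2r ?f_gt0//.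
by rewrite ge_max !le_max lexx orbT andbT lerB.
Qed.

(** The increment is the integral of [v * f v] over [w < v <= w'], where the integrand is at most
    [C]. The bound serves both continuity in [w] and the error made by shifting the cutoff of a test
    function. *)
Lemma low_value_lipschitz w w' : w <= w' -> low_value f w' - low_value f w <= C * (w' - w).
Proof.
move=> ww'; have i := unit_integrable_low_value.
rewrite -unit_integralB//; apply: unit_integral_near_indicator_le => //.
  exact: unit_integrableB.
move=> v vI; have f0 := f_gt0 vI; have fle := f_le vI.
move: vI; rewrite in_itv/= => /andP[v0 v1].
case: (leP v w) => vw; first by rewrite (le_trans vw ww')/= subrr mulr0.
by case: ifP => /= _; nra.
Qed.

Lemma surplus_lipschitz w w' : w <= w' -> surplus f w - surplus f w' <= C * (w' - w).
Proof.
move=> ww'; have i := unit_integrable_surplus_density.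
rewrite -unit_integralB// -[leRHS](unit_integral_cst (C * (w' - w))).
apply: le_unit_integral; [exact: unit_integrableB|exact: unit_integrable_cst|].
apply: ae_unitW => v vI; have f0 := f_gt0 vI; have fle := f_le vI; rewrite -mulrBl.
have : Num.max (v - w) 0 - Num.max (v - w') 0 <= w' - w.
  by case: (leP (v - w) 0) => ?; case: (leP (v - w') 0) => ?; lra.
have : 0 <= Num.max (v - w) 0 - Num.max (v - w') 0.
  by case: (leP (v - w) 0) => ?; case: (leP (v - w') 0) => ?; lra.
by nra.
Qed.

Lemma low_value_gt0 w : 0 < w -> 0 < low_value f w.
Proof.
move=> w0; rewrite ltNge; apply/negP => le0.
have H : ae_unit (fun v => (if v <= w then v else 0) * f v = 0).
  apply: unit_integral_eq0 => //; first exact: unit_integrable_low_value.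
  apply: ae_unitW => v vI; rewrite mulr_ge0 ?(ltW (f_gt0 vI))//; case: ifP => // _.
  by move: vI; rewrite in_itv/= => /andP[].
have [v vI [/andP[v0 vw] /eqP]] := ae_unit_exists (lexx 0) w0 ltr01 H.
by rewrite (ltW vw) mulf_eq0 !gt_eqF// f_gt0.
Qed.

Lemma surplus_gt0 w : 0 <= w -> w < 1 -> 0 < surplus f w.
Proof.
move=> w0 w1; rewrite ltNge; apply/negP => le0.
have H : ae_unit (fun v => Num.max (v - w) 0 * f v = 0).
  apply: unit_integral_eq0 => //; first exact: unit_integrable_surplus_density.
  by apply: ae_unitW => v vI; rewrite mulr_ge0 ?(ltW (f_gt0 vI))// le_max lexx orbT.
have [v vI [/andP[v0 vw] /eqP]] := ae_unit_exists w0 w1 w1 H.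
by rewrite mulf_eq0 !gt_eqF ?f_gt0// lt_max subr_gt0 v0.
Qed.

Lemma low_value0 : low_value f 0 = 0.
Proof.
rewrite -[RHS](unit_integral_cst (0 : R)); apply: unit_integral_eq => v.
rewrite in_itv/= => /andP[v0 _]; case: ifP; last by rewrite mul0r.
by move=> v0'; have -> : v = 0 by [apply/eqP; rewrite eq_le v0 v0']; rewrite mul0r.
Qed.

Lemma surplus1 : surplus f 1 = 0.
Proof.
rewrite -[RHS](unit_integral_cst (0 : R)); apply: unit_integral_eq => v.
by rewrite in_itv/= => /andP[_ v1]; rewrite max_r ?mul0r// subr_le0.
Qed.

End Values.

Lemma lipschitz_continuous (R : realType) (h : R -> R) (C : R) : 0 <= C ->
  (forall x y, x <= y -> `|h y - h x| <= C * (y - x)) -> continuous h.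
Proof.
move=> C0 hC x; apply/cvgrPdist_le => e e0.
(* The constant [C] may be 0, hence the radius [e / (C + 1)]. *)
have C1 : 0 < C + 1 by rewrite ltr_pwDr.
have d0 : 0 < e / (C + 1) by rewrite divr_gt0.
near=> y.
have xy : `|x - y| <= e / (C + 1).
  by near: y; apply: cvgr_dist_le => //; exact: cvg_id.
have : `|h x - h y| <= C * `|x - y|.
  case: (leP x y) => [xy'|/ltW yx].
    by rewrite distrC (distrC x) (ger0_norm (x := y - x)) ?subr_ge0// hC.
  by rewrite (ger0_norm (x := x - y)) ?subr_ge0// hC.
move/le_trans; apply; apply: (@le_trans _ _ (C * (e / (C + 1)))).
  by rewrite ler_wpM2l.
rewrite mulrCA ler_piMr ?(ltW e0)// ler_pdivrMr// mul1r; lra.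
Unshelve. all: by end_near. Qed.

(** * Core outcomes *)

Definition payoff (R : realType) (D : firm_outcome R) (g : worker_group) (v : R) : R :=
  (v - wage D g v) * hire D g v.

(** The condition of [blocks] at a single type. In order: match the own wage and outbid the rival;
    match the own wage and leave the rival's workers alone; outbid the rival and do without the
    former own workers; use only the unemployed. *)
Definition blocking_option (R : realType) (f : worker_group -> R -> R)
    (O : firm -> firm_outcome R) (j : firm) (D : firm_outcome R)
    (g : worker_group) (v : R) : Prop :=
  [\/ wage D g v >= wage (O j) g v /\ wage D g v > wage (O (other_firm j)) g v,
      wage D g v >= wage (O j) g v /\ hire D g v + hire (O (other_firm j)) g v <= f g v,
      wage D g v > wage (O (other_firm j)) g v /\ hire D g v + hire (O j) g v <= f g v |
      hire D g v + hire (O j) g v + hire (O (other_firm j)) g v <= f g v].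

(** * Consequences of the EPSW restriction *)

(** Two sets of types that violate EPSW in [D] carry positive hires and the same wages in [Oi], so
    they violate it there too. The hired amounts may change freely. *)
Lemma epsw_sub (R : realType) (Oi D : firm_outcome R) : epsw Oi ->
  (forall g v, v \in `[0, 1] -> 0 < hire D g v ->
     0 < hire Oi g v /\ wage D g v = wage Oi g v) ->
  epsw D.
Proof.
move=> eO sub [g [V [V' [[mV VI V0] [mV' VI' V0'] hV hV' lt]]]].
apply: eO; exists g, V, V'; split=> //.
- by move=> v Vv; have [] := sub g v (VI _ Vv) (hV _ Vv).
- by move=> v Vv; have [] := sub (other_group g) v (VI' _ Vv) (hV' _ Vv).
- rewrite (_ : [set _ | v in V] = [set (wage D g v)%:E | v in V]); last first.
    by apply: eq_imagel => v Vv; have [_ ->] := sub g v (VI _ Vv) (hV _ Vv).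
  rewrite (_ : [set _ | v in V'] = [set (wage D (other_group g) v)%:E | v in V'])//.
  apply: eq_imagel => v Vv.
  by have [_ ->] := sub (other_group g) v (VI' _ Vv) (hV' _ Vv).
Qed.

Lemma epsw_common_wage (R : realType) (D : firm_outcome R) (w : R) :
  (forall g v, v \in `[0, 1] -> 0 < hire D g v -> wage D g v = w) -> epsw D.
Proof.
move=> Dw [g [V [V' [[mV VI V0] [mV' VI' V0'] hV hV' lt]]]].
have ne (X : set R) : (0 < lebesgue_measure X)%E -> X !=set0.
  by move=> X0; apply/set0P/eqP => X00; rewrite X00 measure0 ltxx in X0.
have [v Vv] := ne _ V0; have [v' Vv'] := ne _ V0'.
have := lt; apply/negP; rewrite -leNgt (@le_trans _ _ w%:E)//.
  by apply: ereal_inf_lbound; exists v' => //; rewrite Dw//; [exact: VI'|exact: hV'].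
by apply: ereal_sup_ubound; exists v => //; rewrite Dw//; [exact: VI|exact: hV].
Qed.

Lemma epsw_single_group (R : realType) (D : firm_outcome R) (g : worker_group) :
  (forall v, v \in `[0, 1] -> hire D (other_group g) v = 0) -> epsw D.
Proof.
move=> D0 [h [V [V' [[mV VI V0] [mV' VI' V0'] hV hV' lt]]]].
have ne (X : set R) : (0 < lebesgue_measure X)%E -> X !=set0.
  by move=> X0; apply/set0P/eqP => X00; rewrite X00 measure0 ltxx in X0.
have [v Vv] := ne _ V0; have [v' Vv'] := ne _ V0'.
have := hV _ Vv; have := hV' _ Vv'.
by case: g h {hV hV' lt} D0 => -[] /= D0; rewrite ?(D0 _ (VI _ Vv)) ?(D0 _ (VI' _ Vv')) ltxx.
Qed.

Lemma measurable_unit_set (R : realType) (b : R -> bool) :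
  measurable_fun (`[0, 1] : set R) b ->
  measurable [set v : R | v \in `[0%R, 1%R] /\ b v].
Proof.
move=> mb; rewrite (_ : mkset _ = `[0, 1] `&` b @^-1` [set true]); last first.
  by apply/seteqP; split.
exact: mb.
Qed.

Lemma ae_unit_not (R : realType) (b : R -> bool) :
  measurable_fun (`[0, 1] : set R) b ->
  ~ (0 < lebesgue_measure ([set v : R | v \in `[0%R, 1%R] /\ b v]))%E ->
  ae_unit (fun v => ~~ b v).
Proof.
move=> mb /negP; rewrite -leNgt => N0.
have mX := measurable_unit_set mb.
exists [set v : R | v \in `[0%R, 1%R] /\ b v]; split => //.
  by apply/eqP; rewrite eq_le N0 measure_ge0.
by move=> v /= /not_implyP[vI /negP/negPn bv].
Qed.

(** If both level sets had positive measure, they would violate EPSW: the wages on the first have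
    supremum at most [p], those on the second infimum at least [q], and [p < q]. *)
Lemma epsw_ae_or (R : realType) (D : firm_outcome R) (p q : R) (g : worker_group) :
  (forall g, measurable_fun (`[0, 1] : set R) (hire D g)) ->
  (forall g, measurable_fun (`[0, 1] : set R) (wage D g)) ->
  epsw D -> p < q ->
  ae_unit (fun v => ~~ ((0 < hire D g v) && (wage D g v <= p))) \/
  ae_unit (fun v => ~~ ((0 < hire D (other_group g) v) && (q <= wage D (other_group g) v))).
Proof.
move=> mh mw eD pq; apply: contrapT => /not_orP[H1 H2]; apply: eD.
pose b v := (0 < hire D g v) && (wage D g v <= p).
pose c v := (0 < hire D (other_group g) v) && (q <= wage D (other_group g) v).
have mb : measurable_fun (`[0, 1] : set R) b by rewrite /b; measurability.
have mc : measurable_fun (`[0, 1] : set R) c by rewrite /c; measurability.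
exists g, [set v : R | v \in `[0%R, 1%R] /\ b v], [set v : R | v \in `[0%R, 1%R] /\ c v].
split.
- split; [exact: measurable_unit_set|by move=> v []|].
  by apply: contrapT => H; apply: H1; exact: ae_unit_not.
- split; [exact: measurable_unit_set|by move=> v []|].
  by apply: contrapT => H; apply: H2; exact: ae_unit_not.
- by move=> v [_ /andP[]].
- by move=> v [_ /andP[]].
- apply: (@le_lt_trans _ _ p%:E).
    by apply: ge_ereal_sup => _ [v [_ /andP[_ vp]] <-]; rewrite lee_fin.
  apply: (@lt_le_trans _ _ q%:E); first by rewrite lte_fin.
  by apply: le_ereal_inf_tmp => _ [v [_ /andP[_ vp]] <-]; rewrite lee_fin.
Qed.

Lemma ae_unit_forall_rat (R : realType) (P : rat -> R -> Prop) :
  (forall q, ae_unit (P q)) -> ae_unit (fun v => forall q, P q v).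
Proof.
move=> H.
have : \forall v \ae (@lebesgue_measure R), forall n : nat,
    forall q, unpickle n = Some q -> v \in `[0, 1] -> P q v.
  apply: ae_foralln => n; case En : (unpickle n : option rat) => [q|]; last exact: aeW.
  by have := H q; rewrite /ae_unit; apply: filterS => v Pv _ [<-].
rewrite /ae_unit; apply: filterS => v Pv vI q; exact: (Pv (pickle q) q (pickleK q)).
Qed.

(** * Wages and hires in a core outcome *)

Section Core.
Context (R : realType) (beta : R) (f : worker_group -> R -> R) (C : R).
Hypothesis beta1 : 1 <= beta.
Hypothesis mf : forall g, measurable_fun (`[0, 1] : set R) (f g).
Hypothesis f_gt0 : forall g v, v \in `[0, 1] -> 0 < f g v.
Hypothesis f_le : forall g v, v \in `[0, 1] -> f g v <= C.
Context (O : firm -> firm_outcome R).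
Hypothesis coreO : core_outcome beta f O.
Implicit Types (g : worker_group) (i j : firm) (v w : R).

Definition weight g : R := if g is GroupA then beta else 1.

Lemma weight_gt0 g : 0 < weight g.
Proof. by case: g => /=; rewrite ?ltr01// (lt_le_trans ltr01). Qed.

Lemma bound_ge0 : 0 <= C.
Proof.
have I0 : (0 : R) \in `[0, 1] by rewrite in_itv/= lexx ler01.
by rewrite ltW// (lt_le_trans (f_gt0 GroupA I0)) ?f_le.
Qed.

Lemma measurable_hire j g : measurable_fun (`[0, 1] : set R) (hire (O j) g).
Proof. by case: coreO => -[H _] _; have [+ _] := H j => /(_ g) []. Qed.

Lemma measurable_wage j g : measurable_fun (`[0, 1] : set R) (wage (O j) g).
Proof. by case: coreO => -[H _] _; have [+ _] := H j => /(_ g) []. Qed.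

Lemma hire_ge0 j g v : v \in `[0, 1] -> 0 <= hire (O j) g v.
Proof.
move=> vI; case: coreO => -[H _] _; have [+ _] := H j => /(_ g) [_ _].
by move=> /(_ v vI) [/andP[]].
Qed.

Lemma hire_le j g v : v \in `[0, 1] -> hire (O j) g v <= f g v.
Proof.
move=> vI; case: coreO => -[H _] _; have [+ _] := H j => /(_ g) [_ _].
by move=> /(_ v vI) [/andP[]].
Qed.

Lemma wage_ge0 j g v : v \in `[0, 1] -> 0 <= wage (O j) g v.
Proof.
move=> vI; case: coreO => -[H _] _; have [+ _] := H j => /(_ g) [_ _].
by move=> /(_ v vI) [].
Qed.

Lemma wage_unhired j g v : v \in `[0, 1] -> hire (O j) g v = 0 -> wage (O j) g v = 0.
Proof.
move=> vI; case: coreO => -[H _] _; have [+ _] := H j => /(_ g) [_ _].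
by move=> /(_ v vI) [].
Qed.

Lemma hire_sum_le j g v : v \in `[0, 1] ->
  hire (O j) g v + hire (O (other_firm j)) g v <= f g v.
Proof.
move=> vI; case: coreO => -[_ H] _; case: j => /=; first exact: H.
by rewrite addrC; exact: H.
Qed.

Lemma epsw_core j : epsw (O j).
Proof. by case: coreO => -[H _] _; have [_] := H j. Qed.

Lemma measurable_payoff j g : measurable_fun (`[0, 1] : set R) (payoff (O j) g).
Proof.
have mh := measurable_hire j g; have mw := measurable_wage j g.
by rewrite /payoff; measurability.
Qed.

Lemma core_deviation j D : epsw_firm_outcome f D ->
  (forall g, ae_unit (blocking_option f O j D g)) ->
  (profit beta D <= profit beta (O j))%E.
Proof.
move=> De Db; rewrite leNgt; apply/negP => lt.
by case: coreO => _; apply; exists j, D; split.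
Qed.

Definition profitR D : R :=
  beta * unit_integral (payoff D GroupA) + unit_integral (payoff D GroupB).

Lemma profitE D : (forall g, unit_integrable (payoff D g)) ->
  profit beta D = (profitR D)%:E.
Proof.
move=> Di; rewrite /profit (unit_integralE (Di GroupA)) (unit_integralE (Di GroupB)).
by rewrite -EFinM -EFinD.
Qed.

(* The profit could still be -oo here, so the comparison with the outcome that
   drops all overpaid workers takes place in \bar R; [n g] is the loss made on
   the overpaid workers of group [g]. *)
Lemma core_wage_le j g : ae_unit (fun v => wage (O j) g v <= v).
Proof.
pose D := FirmOutcome
  (fun g v => if wage (O j) g v <= v then hire (O j) g v else 0)
  (fun g v => if wage (O j) g v <= v then wage (O j) g v else 0).
have mp := measurable_payoff j.
have mh := measurable_hire j; have mw := measurable_wage j.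
have De : epsw_firm_outcome f D.
  split.
    move=> g'; split=> /=; [by measurability|by measurability|].
    move=> v vI; case: ifP => _; rewrite ?lexx ?(ltW (f_gt0 _ vI)) ?hire_ge0 ?hire_le ?wage_ge0//.
    by split=> //; exact: wage_unhired.
  refine (@epsw_sub _ (O j) D (@epsw_core j) _) => g' v vI /=; case: ifP => //.
  by rewrite ltxx.
(* Retained types fall under the second option, dropped types under the fourth. *)
have Db g' : ae_unit (blocking_option f O j D g').
  apply: ae_unitW => v vI; rewrite /blocking_option /=; case: ifP => _.
    by apply: Or42; rewrite lexx; split=> //; exact: hire_sum_le.
  by apply: Or44; rewrite add0r; exact: hire_sum_le.
have Dp g' v : v \in `[0, 1] -> payoff D g' v = Num.max (payoff (O j) g' v) 0.
  move=> vI; rewrite /payoff /=; case: ifP => wv.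
    by rewrite max_l// mulr_ge0 ?hire_ge0// subr_ge0.
  rewrite mulr0 max_r// mulr_le0_ge0 ?hire_ge0// subr_le0 ltW//.
  by rewrite ltNge wv.
have Di g' : unit_integrable (payoff D g').
  apply: (@unit_integrable_ae_bounded _ _ C).
    by rewrite /payoff/=; measurability.
  apply: ae_unitW => v vI; rewrite Dp// ger0_norm ?le_max ?lexx ?orbT//.
  rewrite ge_max bound_ge0 andbT /payoff.
  rewrite (@le_trans _ _ (1 * hire (O j) g' v))//.
    rewrite ler_wpM2r ?hire_ge0//.
    by move: vI (wage_ge0 j g' vI); rewrite in_itv/= => /andP[]; lra.
  by rewrite mul1r (le_trans (hire_le _ _ vI))// f_le.
pose n g' := (\int[lebesgue_measure]_(v in `[0%R, 1%R]) (Num.max (- payoff (O j) g' v) 0)%:E)%E.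
have n0 g' : (0 <= n g')%E.
  by apply: integral_ge0 => v _; rewrite lee_fin le_max lexx orbT.
have pE g' : (\int[lebesgue_measure]_(v in `[0%R, 1%R]) (payoff (O j) g' v)%:E
   = (unit_integral (payoff D g'))%:E - n g')%E.
  rewrite -unit_integralE// integralE; congr (_ - _)%E.
    by apply: eq_integral => v /set_mem vI; rewrite funeposE Dp// EFin_max.
  by apply: eq_integral => v /set_mem vI; rewrite funenegE EFin_max.
have : (profit beta D <= profit beta (O j))%E by exact: core_deviation.
rewrite profitE// /profit !pE /profitR => H.
(* An infinite loss would make the profit of [O j] equal to -oo, below the finite profit of [D];
   finite losses must have weighted sum at most 0. *)
have n00 g' : n g' = 0%E.
  have beta0 : 0 < beta by rewrite (lt_le_trans ltr01).
  move: H (n0 GroupA) (n0 GroupB); case En : (n GroupA) => [a| |//];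
    case Em : (n GroupB) => [b| |//].
  - rewrite -!EFinB -!EFinM -!EFinD !lee_fin => H a0 b0.
    have ab : beta * a + b <= 0 by nra.
    have ba : 0 <= beta * a by rewrite mulr_ge0// ltW.
    have [a00 b00] : a = 0 /\ b = 0.
      have : beta * a = 0 by lra.
      by move/eqP; rewrite mulf_eq0 gt_eqF//= => /eqP ?; split=> //; lra.
    by case: g'; rewrite ?En ?Em ?a00 ?b00.
  - by move=> H; exfalso; move: H; rewrite /= addeNy leeNy_eq.
  - by move=> H; exfalso; move: H; rewrite /= gt0_muleNy ?lte_fin// addNye leeNy_eq.
  - by move=> H; exfalso; move: H; rewrite /= addeNy leeNy_eq.
have n_ae : ae_unit (fun v => Num.max (- payoff (O j) g v) 0 = 0).
  have mn : measurable_fun (`[0, 1] : set R) (fun v => Num.max (- payoff (O j) g v) 0).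
    by measurability.
  have : (\int[lebesgue_measure]_(v in `[0%R, 1%R])
      `|(Num.max (- payoff (O j) g v) 0)%:E| = 0)%E.
    rewrite -(n00 g); apply: eq_integral => v _.
    by rewrite gee0_abs// lee_fin le_max lexx orbT.
  move=> /ae_eq_integral_abs; case=> //; first exact/measurable_EFinP.
  move=> N [? ? sub]; exists N; split=> //; apply: subset_trans sub => v /= Nv Hv.
  by apply: Nv => vI; apply: EFin_inj; exact: Hv.
apply: ae_unitS n_ae => v vI.
have := hire_ge0 j g vI; rewrite le_eqVlt => /predU1P[h0 _|h0].
  by rewrite wage_unhired//; move: vI; rewrite in_itv/= => /andP[].
rewrite leNgt => H'; apply/negP => wv; move: H'; rewrite max_l; last first.
  by rewrite oppr_ge0 /payoff; nra.
by rewrite /payoff; nra.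
Qed.

Lemma payoff_ge0 j g : ae_unit (fun v => 0 <= payoff (O j) g v).
Proof.
apply: ae_unitS (core_wage_le j g) => v vI wv.
by rewrite mulr_ge0 ?hire_ge0// subr_ge0.
Qed.

Lemma payoff_le j g v : v \in `[0, 1] -> payoff (O j) g v <= C.
Proof.
move=> vI; rewrite (@le_trans _ _ (1 * hire (O j) g v))//.
  rewrite ler_wpM2r ?hire_ge0//.
  by move: vI (wage_ge0 j g vI); rewrite in_itv/= => /andP[]; lra.
by rewrite mul1r (le_trans (hire_le _ _ vI))// f_le.
Qed.

Lemma unit_integrable_payoff j g : unit_integrable (payoff (O j) g).
Proof.
apply: (@unit_integrable_ae_bounded _ _ C); first exact: measurable_payoff.
by apply: ae_unitS (payoff_ge0 j g) => v vI p0; rewrite ger0_norm// payoff_le.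
Qed.

Lemma core_deviationR j D : epsw_firm_outcome f D ->
  (forall g, ae_unit (blocking_option f O j D g)) ->
  (forall g, unit_integrable (payoff D g)) ->
  profitR D <= profitR (O j).
Proof.
move=> De Db Di; rewrite -lee_fin -!profitE//; first exact: core_deviation.
exact: unit_integrable_payoff.
Qed.

(** Where firm [j] outbids its rival at a wage below [v], hiring the whole type at the current wage
    is allowed by the first option. Since this cannot raise the profit, there was nobody left to
    hire. *)
Lemma core_outbidding_hires_all j g :
  ae_unit (fun v => wage (O (other_firm j)) g v < wage (O j) g v ->
                    wage (O j) g v < v -> hire (O j) g v = f g v).
Proof.
pose k := other_firm j.
pose b g v := (wage (O k) g v < wage (O j) g v) && (wage (O j) g v < v).
pose D := FirmOutcome
  (fun g v => if b g v then f g v else hire (O j) g v) (wage (O j)).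
have mp := measurable_payoff j.
have mh := measurable_hire j; have mw := measurable_wage j.
have mwk := measurable_wage k.
have mb g' : measurable_fun (`[0, 1] : set R) (b g').
  by rewrite /b; measurability.
(* A wage above the rival's is positive, so by the zero-wage convention the type is already hired in
   part; hence [D] inherits EPSW from [O j]. *)
have hgt0 g' v : v \in `[0, 1] -> b g' v -> 0 < hire (O j) g' v.
  move=> vI /andP[lt _]; rewrite lt_neqAle hire_ge0// andbT.
  apply/eqP => /esym/(wage_unhired vI) w0.
  by have := wage_ge0 k g' vI; rewrite leNgt -w0 lt.
have De : epsw_firm_outcome f D.
  split.
    move=> g'; split=> /=; [by measurability|by measurability|].
    move=> v vI; case: ifP => bv; rewrite ?lexx ?(ltW (f_gt0 _ vI)) ?hire_ge0 ?hire_le ?wage_ge0//.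
      by split=> // f0; have := f_gt0 g' vI; rewrite f0 ltxx.
    by split=> //; exact: wage_unhired.
  refine (@epsw_sub _ (O j) D (@epsw_core j) _) => g' v vI /=; case: ifP => // bv _.
  by split=> //; exact: hgt0.
have Db g' : ae_unit (blocking_option f O j D g').
  apply: ae_unitW => v vI; rewrite /blocking_option /=; case: ifP => [/andP[lt _]|_].
    by apply: Or41.
  by apply: Or42; split=> //; exact: hire_sum_le.
have leD g' v : v \in `[0, 1] -> payoff (O j) g' v <= payoff D g' v.
  move=> vI; rewrite /payoff /=; case: ifP => // /andP[_ wv].
  by rewrite ler_wpM2l ?hire_le// subr_ge0 ltW.
have Di g' : unit_integrable (payoff D g').
  apply: (@unit_integrable_ae_bounded _ _ C).
    by rewrite /payoff/=; measurability.
  apply: ae_unitS (payoff_ge0 j g') => v vI p0; rewrite ger0_norm; last first.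
    exact: le_trans (leD _ _ vI).
  rewrite /payoff /=; case: ifP => bv; last exact: payoff_le.
  rewrite (@le_trans _ _ (1 * f g' v))//; last by rewrite mul1r f_le.
  rewrite ler_wpM2r ?(ltW (f_gt0 _ vI))//.
  by move: vI (wage_ge0 j g' vI); rewrite in_itv/= => /andP[]; lra.
have leJ g' : unit_integral (payoff (O j) g') <= unit_integral (payoff D g').
  apply: le_unit_integral => //; first exact: unit_integrable_payoff.
  by apply: ae_unitW => v vI; exact: leD.
(* Each group's payoff weakly rises and the total profit does not, so neither group's payoff
   rises. *)
have eqJ g' : unit_integral (payoff D g') <= unit_integral (payoff (O j) g').
  have := core_deviationR De Db Di; rewrite /profitR.
  have := leJ GroupA; have := leJ GroupB => lB lA.
  have : beta * unit_integral (payoff (O j) GroupA) <= beta * unit_integral (payoff D GroupA).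
    by rewrite ler_pM2l// (lt_le_trans ltr01).
  move=> l1 l2; case: g'; last lra.
  by rewrite -(@ler_pM2l _ beta) ?(lt_le_trans ltr01)//; lra.
have := unit_integral_eq_le (unit_integrable_payoff j g) (Di g)
  (ae_unitW (leD g)) (eqJ g).
apply: ae_unitS => v vI + lt wv; rewrite /payoff /= /b lt wv/=.
by move/(mulfI _); apply; rewrite subr_eq0 gt_eqF.
Qed.

(** * Poaching one group and the balance of profits *)

Let w1 := wage (O Firm1).
Let w2 := wage (O Firm2).
Let h1 := hire (O Firm1).
Let h2 := hire (O Firm2).

(* Where the two firms pay different wages, the worse paying firm gets workers
   only if the better paying one pays exactly [v]; the poacher then leaves the
   latter's workers alone.  Where both pay [v], only the unemployed are worth
   hiring. *)
Definition poach_wage g v : R :=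
  if Num.max (w1 g v) (w2 g v) < v then Num.max (w1 g v) (w2 g v)
  else if Num.min (w1 g v) (w2 g v) < v then Num.min (w1 g v) (w2 g v) else 0.

Definition poach_hire g v : R :=
  if Num.max (w1 g v) (w2 g v) < v then f g v
  else if Num.min (w1 g v) (w2 g v) < v then
    f g v - (if w1 g v < w2 g v then h2 g v else h1 g v)
  else f g v - (h1 g v + h2 g v).

(** The poacher's payoff on one type in the limit of a vanishing raise over [poach_wage]. *)
Definition poach_payoff g v : R := (v - poach_wage g v) * poach_hire g v.

Lemma measurable_poach_wage g : measurable_fun (`[0, 1] : set R) (poach_wage g).
Proof.
have m1 := measurable_wage Firm1; have m2 := measurable_wage Firm2.
by rewrite /poach_wage /w1 /w2; measurability.
Qed.

Lemma measurable_poach_hire g : measurable_fun (`[0, 1] : set R) (poach_hire g).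
Proof.
have m1 := measurable_wage Firm1; have m2 := measurable_wage Firm2.
have n1 := measurable_hire Firm1; have n2 := measurable_hire Firm2.
by rewrite /poach_hire /w1 /w2 /h1 /h2; measurability.
Qed.

Lemma poach_wage_bounds g v : v \in `[0, 1] -> 0 <= poach_wage g v <= v.
Proof.
move=> vI; have := wage_ge0 Firm1 g vI; have := wage_ge0 Firm2 g vI.
rewrite -/(w1 g v) -/(w2 g v) /poach_wage => a b.
case: ifP => [lt|_]; first by rewrite (ltW lt) le_max a orbT.
case: ifP => [lt|_]; first by rewrite (ltW lt) le_min a b.
by rewrite lexx; move: vI; rewrite in_itv/= => /andP[].
Qed.

Lemma poach_hire_bounds g v : v \in `[0, 1] -> 0 <= poach_hire g v <= f g v.
Proof.
move=> vI; have := hire_ge0 Firm1 g vI; have := hire_ge0 Firm2 g vI.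
have := hire_sum_le Firm1 g vI.
rewrite -/(h1 g v) /= -/(h2 g v) /poach_hire => *.
by do ![case: ifP => _]; apply/andP; split; lra.
Qed.

Lemma unit_integrable_poach g : unit_integrable (poach_payoff g).
Proof.
apply: (@unit_integrable_ae_bounded _ _ C).
  have m1 := measurable_poach_wage; have m2 := measurable_poach_hire.
  by rewrite /poach_payoff; measurability.
apply: ae_unitW => v vI; have /andP[a b] := poach_wage_bounds g vI.
have /andP[c d] := poach_hire_bounds g vI; have e := f_le g vI.
rewrite ger0_norm /poach_payoff; last by rewrite mulr_ge0// subr_ge0.
by move: vI; rewrite in_itv/= => /andP[v0 v1]; nra.
Qed.

Definition same_group (g g' : worker_group) : bool :=
  match g, g' with
  | GroupA, GroupA | GroupB, GroupB => true
  | _, _ => false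
  end.

(** Firm [j] gives up the other group, which makes EPSW vacuous, and offers [poach_wage] plus a
    raise [e] to group [g]. The raise costs at most [e * C] per unit of mass, and [e] tends to 0. *)
Lemma poach_profit_le j g : weight g * unit_integral (poach_payoff g) <= profitR (O j).
Proof.
have m1 := measurable_poach_wage; have m2 := measurable_poach_hire.
suff H e : 0 < e ->
    weight g * (unit_integral (poach_payoff g) - e * C) <= profitR (O j).
  apply/ler_addgt0Pr => e e0; have := weight_gt0 g => wg0.
  have K0 : 0 < weight g * (C + 1) by rewrite mulr_gt0// ltr_pwDr// bound_ge0.
  have := H (e / (weight g * (C + 1))) (divr_gt0 e0 K0).
  have : weight g * (e / (weight g * (C + 1)) * C) <= e.
    have -> : weight g * (e / (weight g * (C + 1)) * C) = e * (C / (C + 1)).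
      by field; rewrite !gt_eqF// ltr_pwDr// bound_ge0.
    by rewrite ler_piMr ?(ltW e0)// ler_pdivrMr ?mul1r ?lerDl// ltr_pwDr// bound_ge0.
  by rewrite mulrBr; lra.
move=> e0.
(* The wage is reset to 0 where nobody is hired, as feasibility demands. *)
pose D := FirmOutcome
  (fun g' v => if same_group g g' then poach_hire g' v else 0)
  (fun g' v => if same_group g g' then
     (if poach_hire g' v == 0 then 0 else poach_wage g' v + e) else 0).
have De : epsw_firm_outcome f D.
  split; last first.
    by apply: (@epsw_single_group _ D g) => v vI /=; case: (g).
  move=> g'; split=> /=; [by case: same_group; measurability..|].
  move=> v vI; have /andP[a b] := poach_hire_bounds g' vI.
  have /andP[c _] := poach_wage_bounds g' vI.
  case: same_group; rewrite ?lexx ?(ltW (f_gt0 _ vI))// a b; split=> //.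
    by case: ifP => // _; rewrite addr_ge0// ltW.
  by move=> ->; rewrite eqxx.
(* Above both wages the first option applies. Above the lower wage only, the better payer keeps its
   workers: the second option if that firm is the rival, the third if it is [j]. The unemployed come
   under the fourth. *)
have Db g' : ae_unit (blocking_option f O j D g').
  apply: ae_unitW => v vI; rewrite /blocking_option /=.
  have s := hire_sum_le j g' vI.
  case: same_group; last by apply: Or44; rewrite add0r.
  case: eqP => [->|_]; first by apply: Or44; rewrite add0r.
  move: s; rewrite /poach_wage /poach_hire.
  case: j => /=; rewrite -/(h1 g' v) -/(h2 g' v) -/(w1 g' v) -/(w2 g' v).
    case: ifP => _.
      by move=> _; apply: Or41; case: (leP (w1 g' v) (w2 g' v)) => ?; split; lra.
    case: ifP => _; last by move=> _; apply: Or44; lra.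
    case: (ltP (w1 g' v) (w2 g' v)) => ? ?; last by apply: Or43; split; lra.
    by apply: Or42; split; lra.
  case: ifP => _.
    by move=> _; apply: Or41; case: (leP (w1 g' v) (w2 g' v)) => ?; split; lra.
  case: ifP => _; last by move=> _; apply: Or44; lra.
  case: (ltP (w1 g' v) (w2 g' v)) => ? ?; first by apply: Or43; split; lra.
  by apply: Or42; split; lra.
have pD g' v : payoff D g' v =
    if same_group g g' then poach_payoff g' v - e * poach_hire g' v else 0.
  rewrite /payoff /poach_payoff /=; case: same_group; last by rewrite mulr0.
  by case: eqP => [->|_]; ring.
have ihire g' : unit_integrable (poach_hire g').
  apply: (@unit_integrable_ae_bounded _ _ C) => //; apply: ae_unitW => v vI.
  have /andP[a b] := poach_hire_bounds g' vI.
  by rewrite ger0_norm// (le_trans b)// f_le.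
have iD g' : unit_integrable (payoff D g').
  rewrite (_ : payoff D g' = fun v =>
    if same_group g g' then poach_payoff g' v - e * poach_hire g' v else 0).
    case: same_group; last exact: unit_integrable_cst.
    apply: unit_integrableB; first exact: unit_integrable_poach.
    exact: unit_integrableZ.
  by apply/funext => v; exact: pD.
have JD : unit_integral (payoff D g) = unit_integral (poach_payoff g) -
    e * unit_integral (poach_hire g).
  rewrite -unit_integralZ// -unit_integralB//.
  - by apply: unit_integral_eq => v _; rewrite pD; case: (g).
  - exact: unit_integrable_poach.
  - exact: unit_integrableZ.
have JD' : unit_integral (payoff D (other_group g)) = 0.
  rewrite -[RHS](unit_integral_cst (0 : R)).
  by apply: unit_integral_eq => v _; rewrite pD; case: (g).
have hC : unit_integral (poach_hire g) <= C.
  rewrite -(unit_integral_cst C); apply: le_unit_integral => //.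
    exact: unit_integrable_cst.
  apply: ae_unitW => v vI; have /andP[_ b] := poach_hire_bounds g vI.
  by rewrite (le_trans b)// f_le.
apply: le_trans (core_deviationR De Db iD).
have -> : profitR D = weight g * unit_integral (payoff D g).
  by rewrite /profitR; move: JD'; case: (g) => /= ->; rewrite ?mulr0 ?addr0 ?add0r ?mul1r.
rewrite JD ler_pM2l ?weight_gt0// lerB//.
by rewrite ler_pM2l.
Qed.

(** Three cases. If the wages differ and the higher is below [v], the better payer employs the whole
    type and both sides agree. If the higher equals [v], its payer earns nothing and the other firm
    hires at most the rest. If the wages coincide, the two firms together hire at most [f g v]. In
    the last two cases equality forces full employment, because the margin in [poach_payoff] is
    positive. *)
Lemma poach_payoff_ge g : ae_unit (fun v =>
  payoff (O Firm1) g v + payoff (O Firm2) g v <= poach_payoff g v /\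
  (payoff (O Firm1) g v + payoff (O Firm2) g v = poach_payoff g v ->
     h1 g v + h2 g v = f g v)).
Proof.
apply: ae_unitS3 (ae_unitI (core_wage_le Firm1 g) (core_wage_le Firm2 g))
  (ae_unitI (core_outbidding_hires_all Firm1 g) (core_outbidding_hires_all Firm2 g))
  (ae_unit_neq 0) => v vI [wv1 wv2] /= [] + + /eqP v_neq0.
(* When both firms pay exactly [v], the margin on the unemployed is [v] itself. *)
have v0 : 0 < v.
  by move: vI; rewrite in_itv/= => /andP[+ _]; rewrite le_eqVlt => /orP[/eqP/esym//|].
have := wage_ge0 Firm1 g vI; have := wage_ge0 Firm2 g vI.
have := hire_ge0 Firm1 g vI; have := hire_ge0 Firm2 g vI.
have := hire_sum_le Firm1 g vI; rewrite /=.
have := @wage_unhired Firm1 g v vI; have := @wage_unhired Firm2 g v vI.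
have := f_gt0 g vI.
rewrite /payoff /poach_payoff /poach_wage /poach_hire -!/(w1 g v) -!/(w2 g v).
rewrite -!/(h1 g v) -!/(h2 g v).
move: wv1 wv2; rewrite -!/(w1 g v) -!/(w2 g v).
move: (w1 g v) (w2 g v) (h1 g v) (h2 g v) (f g v) => a b x y F.
move=> av bv F0 yb xa xyF y0 x0 b0 a0 ax by_.
case: (ltgtP a b) => [ab|ba|eq_ab].
- case: ifP => [bv'|/negbT]; last rewrite -leNgt => bv'.
    by have yF := by_ ab bv'; have x00 : x = 0; [lra|rewrite x00 yF !mulr0 !add0r].
  have eq_bv : b = v by apply/eqP; rewrite eq_le bv bv'.
  rewrite -eq_bv ab subrr mul0r addr0; split.
    by rewrite ler_wpM2l//; lra.
  by move/mulfI => H; have := H _; rewrite subr_eq0 gt_eqF// => /(_ isT); lra.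
- case: ifP => [av'|/negbT]; last rewrite -leNgt => av'.
    by have xF := ax ba av'; have y00 : y = 0; [lra|rewrite y00 xF !mulr0 !addr0].
  have eq_av : a = v by apply/eqP; rewrite eq_le av av'.
  rewrite -eq_av ba subrr mul0r add0r; split.
    by rewrite ler_wpM2l//; lra.
  by move/mulfI => H; have := H _; rewrite subr_eq0 gt_eqF// => /(_ isT); lra.
- rewrite -eq_ab in bv *; case: ifP => [av'|/negbT]; last rewrite -leNgt => av'.
    rewrite -mulrDr ler_wpM2l ?subr_ge0//; split=> //.
    by move/mulfI; apply; rewrite subr_eq0 gt_eqF.
  have eq_av : a = v by apply/eqP; rewrite eq_le av av'.
  rewrite eq_av subrr !mul0r addr0 ltxx subr0; split; first by rewrite mulr_ge0// ?(ltW v0)//; lra.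
  by move/esym/eqP; rewrite mulf_eq0 gt_eqF//= => /eqP; lra.
Qed.

Lemma group_profit_le g : weight g * (unit_integral (payoff (O Firm1) g) +
  unit_integral (payoff (O Firm2) g)) <= weight g * unit_integral (poach_payoff g).
Proof.
rewrite ler_pM2l ?weight_gt0// -unit_integralD; [|exact: unit_integrable_payoff..].
apply: le_unit_integral; first by apply: unit_integrableD; exact: unit_integrable_payoff.
  exact: unit_integrable_poach.
by apply: ae_unitS (poach_payoff_ge g) => v _ [].
Qed.

(** Each firm's profit is at least each poaching profit, which is at least the joint profit on that
    group. The two profits and the two joint profits have the same sum, so all these inequalities
    are equalities. *)
Lemma core_profit_balance :
  exists p, (forall j, profitR (O j) = p) /\
    forall g, weight g * (unit_integral (payoff (O Firm1) g) +
      unit_integral (payoff (O Firm2) g)) = p /\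
      weight g * unit_integral (poach_payoff g) = p.
Proof.
have A := group_profit_le GroupA; have B := group_profit_le GroupB.
have A1 := poach_profit_le Firm1 GroupA; have A2 := poach_profit_le Firm2 GroupA.
have B1 := poach_profit_le Firm1 GroupB; have B2 := poach_profit_le Firm2 GroupB.
exists (profitR (O Firm1)); move: A B A1 A2 B1 B2; rewrite /profitR /= mulrDr => *.
by split; [case; lra|case=> /=; rewrite ?mulrDr; split; lra].
Qed.

(** The balance of profits makes the poaching bound an equality for almost all types, and its
    equality case is full employment. *)
Lemma core_full_employment g : ae_unit (fun v => h1 g v + h2 g v = f g v).
Proof.
have [p [_ /(_ g)[Pp Sp]]] := core_profit_balance.
have i1 := unit_integrable_payoff Firm1 g; have i2 := unit_integrable_payoff Firm2 g.
have H : ae_unit (fun v =>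
    payoff (O Firm1) g v + payoff (O Firm2) g v = poach_payoff g v).
  apply: unit_integral_eq_le; first exact: unit_integrableD.
  - exact: unit_integrable_poach.
  - by apply: ae_unitS (poach_payoff_ge g) => v _ [].
  - rewrite unit_integralD// -(@ler_pM2l _ (weight g)) ?weight_gt0//.
    by rewrite Pp Sp.
by apply: ae_unitS2 H (poach_payoff_ge g) => v _ eq_v [_]; exact.
Qed.

(** * Integrated firms *)

Definition idle j g : Prop := ae_unit (fun v => hire (O j) g v = 0).

Lemma not_idle_witness j g (P : R -> Prop) : ~ idle j g -> ae_unit P ->
  exists v, [/\ v \in `[0, 1], 0 < hire (O j) g v & P v].
Proof.
move=> nid Pae; apply: contrapT => H; apply: nid.
apply: ae_unitS Pae => v vI Pv; apply/eqP; apply: contrapT => /negP h0.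
by apply: H; exists v; split=> //; rewrite lt_neqAle eq_sym h0 hire_ge0.
Qed.

(** For almost all hired types, EPSW bounds wages across groups in both directions. Comparing every
    type with one fixed hired type of the other group then gives a single wage. *)
Lemma integrated_common_wage j : ~ idle j GroupA -> ~ idle j GroupB ->
  exists w, 0 <= w /\
    forall g, ae_unit (fun v => 0 < hire (O j) g v -> wage (O j) g v = w).
Proof.
move=> nA nB; pose D := O j.
pose lo g (q : rat) v := (0 < hire D g v) && (wage D g v <= ratr q).
pose hi g (q : rat) v := (0 < hire D g v) && (ratr q <= wage D g v).
(* [v] lies in no null level set with a rational threshold, so two good points
   with different wages would violate EPSW. *)
pose good g v := forall q,
  (ae_unit (fun u => ~~ lo g q u) -> ~~ lo g q v) /\
  (ae_unit (fun u => ~~ hi g q u) -> ~~ hi g q v).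
have good_ae g : ae_unit (good g).
  apply: ae_unit_forall_rat => q; apply: ae_unitI.
    have [H|H] := pselect (ae_unit (fun u => ~~ lo g q u)); last exact: ae_unitW.
    by apply: ae_unitS H.
  have [H|H] := pselect (ae_unit (fun u => ~~ hi g q u)); last exact: ae_unitW.
  by apply: ae_unitS H.
have le_wage g u v : good g u -> good (other_group g) v ->
    0 < hire D g u -> 0 < hire D (other_group g) v ->
    wage D (other_group g) v <= wage D g u.
  move=> gu gv hu hv; rewrite leNgt; apply/negP => lt.
  (* Rationals [p < q] strictly between the two wages put [u] in a low level set and [v] in a high
     one; EPSW makes one of these sets null, against goodness of the point. *)
  have [q /andP[uq qv]] := rat_in_itvoo lt.
  have [p /andP[up pq]] := rat_in_itvoo uq.
  have [H|H] := @epsw_ae_or R D (ratr p) (ratr q) g (measurable_hire j)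
    (measurable_wage j) (@epsw_core j) pq.
    by have [/(_ H) + _] := gu p; rewrite /lo hu (ltW up).
  by have [_ /(_ H)] := gv q; rewrite /hi hv (ltW qv).
have [b [bI hb gb]] := not_idle_witness nB (good_ae GroupB).
have [a [aI ha ga]] := not_idle_witness nA (good_ae GroupA).
have wab : wage D GroupA a = wage D GroupB b.
  by apply/eqP; rewrite eq_le (@le_wage GroupA a b)// (@le_wage GroupB b a).
exists (wage D GroupB b); split; first exact: wage_ge0.
move=> g; apply: ae_unitS (good_ae g) => v vI gv hv; apply/eqP; case: g gv hv => gv hv.
  by rewrite eq_le (@le_wage GroupA v b)// (@le_wage GroupB b v).
by rewrite -wab eq_le (@le_wage GroupB v a)// (@le_wage GroupA a v).
Qed.

Lemma unit_integrable_surplus g w : unit_integrable (fun v => Num.max (v - w) 0 * f g v).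
Proof.
apply: (unit_integrable_surplus_density (C := C)) => // v vI.
by rewrite f_gt0// f_le.
Qed.

(** Offering [w + e] to all types of both groups above [w + e] outbids every wage and respects EPSW,
    since there is only one wage. The loss relative to the surplus at [w] is at most [e * C] per
    unit of mass, and [e] tends to 0. *)
Lemma uniform_offer_le j w : 0 <= w ->
  (forall i g, ae_unit (fun v => wage (O i) g v <= w)) ->
  beta * surplus (f GroupA) w + surplus (f GroupB) w <= profitR (O j).
Proof.
move=> w0 wle; have C0 := bound_ge0.
have beta0 : 0 < beta by rewrite (lt_le_trans ltr01).
have K0 : 0 < (beta + 1) * (C + 1).
  by rewrite mulr_gt0// ltr_pwDr// ?ltW//.
suff H e : 0 < e -> beta * (surplus (f GroupA) w - e * C) +
    (surplus (f GroupB) w - e * C) <= profitR (O j).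
  apply/ler_addgt0Pr => e e0.
  have := H (e / ((beta + 1) * (C + 1))) (divr_gt0 e0 K0).
  have : (beta + 1) * (e / ((beta + 1) * (C + 1)) * C) <= e.
    have -> : (beta + 1) * (e / ((beta + 1) * (C + 1)) * C) = e * (C / (C + 1)).
      by field; rewrite !gt_eqF// ltr_pwDr ?(ltW beta0)//.
    rewrite ler_piMr ?(ltW e0)// ler_pdivrMr ?mul1r ?lerDl//.
    by rewrite ltr_pwDr//.
  by move: (e / _ * C) => d; rewrite mulrDl mul1r mulrBr; lra.
move=> e0.
pose D := FirmOutcome
  (fun g v => if w + e < v then f g v else 0)
  (fun g v => if w + e < v then w + e else 0).
have De : epsw_firm_outcome f D.
  split; last first.
    by apply: (@epsw_common_wage _ D (w + e)) => g v vI /=; case: ifP => //; rewrite ltxx.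
  move=> g; split=> /=; [by measurability..|].
  move=> v vI; case: ifP => _; rewrite ?lexx ?(ltW (f_gt0 _ vI))//; split=> //.
    by rewrite addr_ge0// ltW.
  by move=> f0; have := f_gt0 g vI; rewrite f0 ltxx.
have Db g : ae_unit (blocking_option f O j D g).
  apply: ae_unitS2 (wle j g) (wle (other_firm j) g) => v vI wj wk.
  rewrite /blocking_option /=; case: ifP => _; first by apply: Or41; split; lra.
  by apply: Or44; rewrite add0r; exact: hire_sum_le.
have iD g : unit_integrable (payoff D g).
  apply: (@unit_integrable_ae_bounded _ _ C); first by rewrite /payoff/=; measurability.
  apply: ae_unitW => v vI; rewrite /payoff/=; case: ifP => [we|_]; last first.
    by rewrite mulr0 normr0.
  have := f_gt0 g vI; have := f_le g vI => fC f0.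
  rewrite ger0_norm; last by rewrite mulr_ge0 ?(ltW f0)//; lra.
  by move: vI; rewrite in_itv/= => /andP[v0 v1]; nra.
have JD g : surplus (f g) w - e * C <= unit_integral (payoff D g).
  have ie : unit_integrable (fun=> e * C) by exact: unit_integrable_cst.
  rewrite -(unit_integral_cst (e * C)) -unit_integralB//; last exact: unit_integrable_surplus.
  apply: le_unit_integral => //;
    first by apply: unit_integrableB => //; exact: unit_integrable_surplus.
  apply: ae_unitW => v vI; rewrite /payoff /=; have := f_gt0 g vI; have := f_le g vI.
  by case: ifP => [we|/negbT]; rewrite -?leNgt => *; case: (leP (v - w) 0) => *; nra.
apply: le_trans (core_deviationR De Db iD); rewrite /profitR.
by rewrite lerD// ler_pM2l.
Qed.

Lemma other_firmK j : other_firm (other_firm j) = j.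
Proof. by case: j. Qed.

Lemma full_employment j g :
  ae_unit (fun v => hire (O j) g v + hire (O (other_firm j)) g v = f g v).
Proof.
case: j; first exact: core_full_employment.
by apply: ae_unitS (core_full_employment g) => v _ /=; rewrite addrC.
Qed.

Lemma idle_rival_hires_all j g : idle j g -> hires_almost_all f (O (other_firm j)) g.
Proof.
move=> id; change (ae_unit (fun v => hire (O (other_firm j)) g v = f g v)).
by apply: ae_unitS2 id (full_employment j g) => v _ ->; rewrite add0r.
Qed.

Lemma idle_rival_not_idle j g : idle j g -> ~ idle (other_firm j) g.
Proof.
move=> idj idk.
have [v vI [_ [[hj hk]]]] := ae_unit_exists (lexx 0) ltr01 ltr01
  (ae_unitI (ae_unitI idj idk) (full_employment j g)).
by rewrite hj hk addr0 => f0; have := f_gt0 g vI; rewrite -f0 ltxx.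
Qed.

Lemma profitRE j : profitR (O j) =
  weight GroupA * unit_integral (payoff (O j) GroupA) +
  weight GroupB * unit_integral (payoff (O j) GroupB).
Proof. by rewrite /profitR /= mul1r. Qed.

Lemma profit_balance : exists p, (forall j, profitR (O j) = p) /\
  forall j g, weight g * (unit_integral (payoff (O j) g) +
    unit_integral (payoff (O (other_firm j)) g)) = p.
Proof.
have [p [pj pg]] := core_profit_balance; exists p; split=> // j g.
by case: j => /=; [|rewrite addrC]; have [] := pg g.
Qed.

Lemma unit_integral_payoff_idle j g : idle j g -> unit_integral (payoff (O j) g) = 0.
Proof.
move=> id; rewrite -[RHS](unit_integral_cst (0 : R)); apply: unit_integral_eq_ae => //.
  exact: measurable_payoff.
by apply: ae_unitS id => v _ h0; rewrite /payoff h0 mulr0.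
Qed.

(** If the rival were idle in group [g], firm [j] would employ all of it at its common wage, which
    must be 0 because of the types near 0. Its payoff on [g] would already be its whole profit, so
    it would earn nothing on the other group; at wage 0 that means hiring almost nobody there. *)
Lemma integrated_rival_not_idle j g :
  ~ idle j GroupA -> ~ idle j GroupB -> ~ idle (other_firm j) g.
Proof.
move=> nA nB idk; have ip := unit_integrable_payoff; have p_ge0 := payoff_ge0.
have [w [w0 wE]] := integrated_common_wage nA nB.
have hall : ae_unit (fun v => hire (O j) g v = f g v).
  by have := idle_rival_hires_all idk; rewrite other_firmK.
have {w0} w0 : w = 0.
  apply/eqP; rewrite eq_le w0 andbT leNgt; apply/negP => w0'.
  have [v vI [/andP[v0 vw] [[hv wv] wle]]] := ae_unit_exists (lexx 0) w0' ltr01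
    (ae_unitI (ae_unitI hall (wE g)) (core_wage_le j g)).
  by move: wle; rewrite wv ?hv ?f_gt0// leNgt vw.
have [p [pj pg]] := profit_balance.
have := pg j g; rewrite (unit_integral_payoff_idle idk) addr0 => pg'.
(* The joint profit on [g] is made by [j] alone and equals the full profit of [j]. *)
have other0 : unit_integral (payoff (O j) (other_group g)) = 0.
  have := pj j; rewrite profitRE; have := weight_gt0 (other_group g).
  move: pg'; case: (g) => /= <- w'; move/eqP.
    by rewrite -subr_eq0 addrC addKr mulf_eq0 gt_eqF//= => /eqP.
  by rewrite -subr_eq0 addrK mulf_eq0 gt_eqF//= => /eqP.
have : ae_unit (fun v => payoff (O j) (other_group g) v = 0).
  by apply: unit_integral_eq0 => //; rewrite other0.
move=> p0; suff : idle j (other_group g) by case: (g).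
apply: ae_unitS3 p0 (wE (other_group g)) (ae_unit_neq 0) => v vI pv wv v0.
apply/eqP; rewrite eq_le hire_ge0// andbT leNgt; apply/negP => h0.
move: pv; rewrite /payoff wv// w0 subr0 => /eqP.
by rewrite mulf_eq0 (negbTE v0)/= gt_eqF.
Qed.

(** The lower wage is 0 and the higher one splits the types: the payoffs of firm [j] are the low
    values at [w'], those of its rival the surpluses. The balance of profits then yields both
    equations with [x] equal to [w']. *)
Lemma both_integrated_equation j w w' : 0 <= w -> w <= w' ->
  (forall g, ae_unit (fun v => 0 < hire (O j) g v -> wage (O j) g v = w)) ->
  (forall g, ae_unit (fun v => 0 < hire (O (other_firm j)) g v ->
     wage (O (other_firm j)) g v = w')) ->
  exists x, beta * low_value (f GroupA) x = surplus (f GroupB) x /\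
    low_value (f GroupB) x = beta * surplus (f GroupA) x.
Proof.
move=> w0 ww' wj wk; pose k := other_firm j; have p_ge0 := payoff_ge0.
(* Otherwise the types strictly between 0 and [w] are employed by someone, at a wage above their
   productivity. *)
have {}w0 : w = 0.
  apply/eqP; rewrite eq_le w0 andbT leNgt; apply/negP => w0'.
  have [v vI [/andP[v0 vw] [[[hv wv] wv'] [wle wle']]]] := ae_unit_exists (lexx 0) w0' ltr01
    (ae_unitI (ae_unitI (ae_unitI (full_employment j GroupA) (wj GroupA)) (wk GroupA))
       (ae_unitI (core_wage_le j GroupA) (core_wage_le k GroupA))).
  have := f_gt0 GroupA vI; have := hire_ge0 j GroupA vI; have := hire_ge0 k GroupA vI.
  rewrite le_eqVlt => /predU1P[hk0|/wv']; last by move: wle' => /[swap] ->; lra.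
  rewrite le_eqVlt => /predU1P[hj0|/wv]; last by move: wle => /[swap] ->; lra.
  by rewrite -hv -/k -hk0 -hj0 addr0 ltxx.
have w'0 : 0 <= w' by rewrite -w0.
have wjE g : ae_unit (fun v => wage (O j) g v = 0).
  apply: ae_unitS (wj g) => v vI wv; have := hire_ge0 j g vI.
  by rewrite le_eqVlt => /predU1P[/esym/(wage_unhired vI)//|/wv ->].
have wkE g : ae_unit (fun v => wage (O k) g v <= w').
  apply: ae_unitS (wk g) => v vI wv; have := hire_ge0 k g vI.
  by rewrite le_eqVlt => /predU1P[/esym/(wage_unhired vI) -> //|/wv ->].
have wle i g : ae_unit (fun v => wage (O i) g v <= w').
  have jle : ae_unit (fun v => wage (O j) g v <= w').
    by apply: ae_unitS (wjE g) => v _ ->.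
  have := wkE g; rewrite /k => kle.
  by move: jle kle; case: (j); case: i.
have pk_le g : ae_unit (fun v => payoff (O k) g v <= Num.max (v - w') 0 * f g v).
  apply: ae_unitS2 (wk g) (core_wage_le k g) => v vI wv wle_v.
  have := hire_ge0 k g vI; have f0 := f_gt0 g vI; have := hire_le k g vI => hf.
  have m0 : 0 <= Num.max (v - w') 0 by rewrite le_max lexx orbT.
  rewrite le_eqVlt => /predU1P[h0|h0].
    by rewrite /payoff -h0 mulr0 mulr_ge0// ltW.
  by rewrite /payoff wv// ler_pM ?(ltW h0)// ?le_max ?lexx// subr_ge0 -(wv h0).
have ip := unit_integrable_payoff; have is_ := unit_integrable_surplus.
have Jle g : unit_integral (payoff (O k) g) <= surplus (f g) w' by exact: le_unit_integral.
have Jge := uniform_offer_le k w'0 wle.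
have beta0 : 0 < beta by rewrite (lt_le_trans ltr01).
(* The surplus at [w'] bounds the rival's payoff group by group, while the uniform offer at [w']
   bounds its total profit from below. *)
have Jeq g : unit_integral (payoff (O k) g) = surplus (f g) w'.
  apply/eqP; rewrite eq_le Jle/=; move: Jge (Jle GroupA) (Jle GroupB).
  rewrite /profitR => H lA lB.
  have : beta * unit_integral (payoff (O k) GroupA) <= beta * surplus (f GroupA) w'.
    by rewrite ler_pM2l.
  case: g => lA'; last by lra.
  by rewrite -(@ler_pM2l _ beta)//; lra.
have pkE g : ae_unit (fun v => payoff (O k) g v = Num.max (v - w') 0 * f g v).
  by apply: unit_integral_eq_le => //; rewrite Jeq.
have low g : unit_integral (payoff (O j) g) = low_value (f g) w'.
  apply: unit_integral_eq_ae; first exact: measurable_payoff.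
    by measurability.
  have H1 := ae_unitI (pkE g) (wk g).
  have H2 := ae_unitI (wjE g) (full_employment j g).
  (* The type [v = w'] is left out: there the payoff of firm [k] does not determine its hiring. *)
  apply: ae_unitS3 (ae_unitI H1 H2) (ae_unit_neq w') (core_wage_le k g).
  move=> v vI [[pv wv] [wjv fv]] vw wle_v; rewrite /payoff wjv subr0.
  have : hire (O k) g v = if v <= w' then 0 else f g v.
    have := hire_ge0 k g vI; case: (ltgtP v w') => [lt|gt|eq_v]; last first.
    - by move: vw; rewrite eq_v eqxx.
    - move=> _; move: pv; rewrite max_l ?subr_ge0 ?ltW// /payoff.
      have := hire_ge0 k g vI; rewrite le_eqVlt => /predU1P[<-|h0].
        rewrite mulr0 => /esym/eqP; rewrite mulf_eq0 subr_eq0 gt_eqF//= => /eqP -> //.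
      by rewrite wv// => /mulfI; apply; rewrite subr_eq0 gt_eqF.
    - rewrite le_eqVlt => /predU1P[//|/wv E]; move: wle_v; rewrite E; lra.
  move=> hk; move: fv; rewrite -/k hk; case: ifP => _; first by rewrite addr0 => ->.
  by move=> E; have -> : hire (O j) g v = 0; [lra|rewrite mul0r mulr0].
have [p [pj pg]] := profit_balance.
have := pg j GroupA; have := pg j GroupB; have := pj k.
rewrite profitRE -/k !low !Jeq /weight !mul1r => e1 e2 e3.
by exists w'; split; lra.
Qed.

(** If each firm were idle in some group, either both would be idle in the same one, against full
    employment, or the outcome would be segregated. So some firm is integrated, hence both are. *)
Lemma core_equation : ~ completely_segregated f O ->
  exists x, beta * low_value (f GroupA) x = surplus (f GroupB) x /\
    low_value (f GroupB) x = beta * surplus (f GroupA) x.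
Proof.
move=> nseg.
have nid j : idle j GroupA -> idle (other_firm j) GroupB -> False.
  move=> idA idB; apply: nseg; exists (other_firm j); split.
    exact: idle_rival_hires_all.
  exact: idle_rival_hires_all.
have [j [nA nB]] : exists j, ~ idle j GroupA /\ ~ idle j GroupB.
  apply: contrapT => H.
  have alt j : idle j GroupA \/ idle j GroupB.
    by apply: contrapT => /not_orP H'; apply: H; exists j.
  have [a1|b1] := alt Firm1; have [a2|b2] := alt Firm2.
  - exact: (idle_rival_not_idle a1 a2).
  - exact: (nid Firm1).
  - exact: (nid Firm2).
  - exact: (idle_rival_not_idle b1 b2).
have [w [w0 wE]] := integrated_common_wage nA nB.
have [w' [w'0 w'E]] := integrated_common_wage
  (integrated_rival_not_idle (g := GroupA) nA nB) (integrated_rival_not_idle (g := GroupB) nA nB).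
(* The two firms may swap roles, so that [j] is the one paying less. *)
case: (leP w w') => [ww'|/ltW ww']; first exact: (both_integrated_equation w0 ww' wE w'E).
by apply: (@both_integrated_equation (other_firm j) w' w) => //; rewrite other_firmK.
Qed.

End Core.

(** * Regular distributions and the weak-* topology *)

Lemma regular_density_bounds (R : realType) (P : probability (measurableTypeR R) R)
    (f : R -> R) : regular_density P f ->
  exists c C, 0 < c /\ forall v, v \in `[0, 1] -> c <= f v <= C.
Proof.
move=> [mf inf_gt0 sup_lty _].
have I0 : (0 : R) \in `[0, 1] by rewrite in_itv/= lexx ler01.
have inf_le v : v \in `[0, 1] -> (ereal_inf [set (f v)%:E | v in `[0%R, 1%R]] <= (f v)%:E)%E.
  by move=> vI; apply: ereal_inf_lbound; exists v.
have sup_ge v : v \in `[0, 1] -> ((f v)%:E <= ereal_sup [set (f v)%:E | v in `[0%R, 1%R]])%E.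
  by move=> vI; apply: ereal_sup_ubound; exists v.
case Ec : ereal_inf inf_gt0 inf_le => [c| |]; last first.
- by [].
- by move=> _ /(_ _ I0); rewrite leye_eq.
rewrite lte_fin => c0 inf_le.
case EC : ereal_sup sup_lty sup_ge => [C| |]; last first.
- by move=> _ /(_ _ I0); rewrite leeNy_eq.
- by [].
move=> _ sup_ge; exists c, C; split=> // v vI.
by rewrite -!lee_fin inf_le// sup_ge.
Qed.

Section Density.
Context (R : realType).
Implicit Types (F : regular_distribution R) (f : R -> R).

Let mI : measurable (`[0, 1] : set (measurableTypeR R)).
Proof. exact: measurable_itv. Qed.

Lemma law_dominated F : law F `<< (@lebesgue_measure R).
Proof.
have [f [mf _ _ fE]] := law_regular F.
apply/null_content_dominatesP => A mA A0; rewrite fE//.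
apply: null_set_integral => //.
- exact: measurableI.
- by apply/measurable_EFinP; apply: measurable_funS mf => //; exact: subIsetr.
- apply: (subset_measure0 _ _ _ A0) => //; exact: measurableI.
Qed.

Lemma unit_integrable_test (phi : test_function R) f C :
  measurable_fun (`[0, 1] : set R) f -> (forall v, v \in `[0, 1] -> 0 < f v <= C) ->
  unit_integrable (fun v => sval phi v * f v).
Proof.
move=> mf fC; have cphi := svalP phi.
have [M [Mr HM]] := compact_bounded (continuous_compact cphi (@segment_compact R 0 1)).
have mphi : measurable_fun (`[0, 1] : set R) (sval phi).
  by apply: subspace_continuous_measurable_fun.
apply: (@unit_integrable_ae_bounded _ _ ((M + 1) * C)); first exact: measurable_funM.
apply: ae_unitW => v vI; have /andP[f0 fle] := fC v vI.
rewrite normrM ler_pM// ?(gtr0_norm f0)//.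
by apply: (HM (M + 1)); [rewrite ltrDl|exists v].
Qed.

(** The change of variables is stated for the Radon-Nikodym derivative [r] of the law. Both [r] and
    [f] integrate to the law over measurable subsets of the unit interval, so they agree there
    almost everywhere. *)
Lemma expectationsE F f (phi : test_function R) : regular_density (law F) f ->
  expectations F phi = unit_integral (fun v => sval phi v * f v).
Proof.
move=> fF; have [c [C [c0 fC]]] := regular_density_bounds fF.
have [mf _ _ fE] := fF.
have cphi := svalP phi.
have mphi : measurable_fun (`[0, 1] : set R) (sval phi).
  by apply: subspace_continuous_measurable_fun.
have [M [Mr HM]] := compact_bounded (continuous_compact cphi (@segment_compact R 0 1)).
have iphi : (law F).-integrable `[0, 1] (EFin \o sval phi).
  apply: measurable_bounded_integrable => //.
    by rewrite (le_lt_trans (probability_le1 _ _))// ltry.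
  exists M; split=> // N MN v vI; by apply: (HM N) => //; exists v.
rewrite /expectations /Rintegral /unit_integral /Rintegral; congr fine.
rewrite -(Radon_Nikodym_change_of_variables (law_dominated F) mI iphi).
have if_ : unit_integrable f.
  apply: (@unit_integrable_ae_bounded _ _ C) => //; apply: ae_unitW => v vI.
  by have /andP[cf fle] := fC v vI; rewrite ger0_norm// (le_trans (ltW c0)).
set r := Radon_Nikodym _ _.
have ir : lebesgue_measure.-integrable (`[0, 1] : set (measurableTypeR R)) r.
  apply: (integrableS measurableT) => //.
  by apply: Radon_Nikodym_integrable; exact: law_dominated.
have rf : ae_eq lebesgue_measure (`[0, 1]%classic : set (measurableTypeR R)) r (EFin \o f).
  apply: integral_ae_eq => //; first exact/measurable_EFinP.
  move=> E EI mE; rewrite -Radon_Nikodym_integral//; last exact: law_dominated.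
  by change (law F E = (\int[lebesgue_measure]_(v in E) (f v)%:E)%E); rewrite fE// setIidl.
apply: ae_eq_integral => //.
- apply: emeasurable_funM; first exact/measurable_EFinP.
  exact: measurable_int ir.
- by apply/measurable_EFinP; exact: measurable_funM.
- move: rf; rewrite /ae_eq; apply: filterS => v rv vI /=.
  by rewrite rv// EFinM.
Qed.

End Density.

(** * Laws with a prescribed density *)

Section DensityLaw.
Context (R : realType) (f : R -> R).
Hypothesis mf : measurable_fun (`[0, 1] : set R) f.
Hypothesis f_ge0 : forall v, v \in `[0, 1] -> 0 <= f v.
Hypothesis f_int : unit_integrable f.
Hypothesis f_total : unit_integral f = 1.

(** The density is extended by 0 to the whole line, so that countable additivity is that of the
    integral of a nonnegative function. *)
Definition density_law (X : set (measurableTypeR R)) : \bar R :=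
  (\int[lebesgue_measure]_(v in X) ((f \_ `[0%R, 1%R]) v)%:E)%E.

Let fI_ge0 v : 0 <= (f \_ `[0%R, 1%R]) v.
Proof. by rewrite patchE; case: ifPn => // /set_mem; exact: f_ge0. Qed.

Let mfI : measurable_fun (setT : set (measurableTypeR R)) (f \_ `[0%R, 1%R]).
Proof.
by apply/(measurable_restrictT _ _).1 => //; exact: measurable_itv.
Qed.

Let density_law0 : density_law set0 = 0%E.
Proof. by rewrite /density_law integral_set0. Qed.

Let density_law_ge0 X : (0 <= density_law X)%E.
Proof. by apply: integral_ge0 => v _; rewrite lee_fin. Qed.

Let density_law_sigma_additive : semi_sigma_additive density_law.
Proof.
move=> /= F mF tF mUF; rewrite /density_law; apply: cvg_toP.
  apply: ereal_nondecreasing_is_cvgn => m n mn.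
  apply: lee_sum_nneg_natr => // k _ _.
  by apply: integral_ge0 => /= x Fkx; rewrite lee_fin.
rewrite ge0_integral_bigcup//=.
- by apply: measurable_funTS; apply/measurable_EFinP.
- by move=> x _; rewrite lee_fin.
Qed.

HB.instance Definition _ := isMeasure.Build _ _ _ density_law
  density_law0 density_law_ge0 density_law_sigma_additive.

Let density_lawE X :
  density_law X = (\int[lebesgue_measure]_(v in X `&` `[0%R, 1%R]) (f v)%:E)%E.
Proof. by rewrite /density_law [RHS]integral_mkcondr/= restrict_EFin. Qed.

Let density_lawT : density_law setT = 1%E.
Proof. by rewrite density_lawE setTI unit_integralE// f_total. Qed.

HB.instance Definition _ := @Measure_isProbability.Build _ _ R
  density_law density_lawT.

Lemma exists_law_of_density :
  exists P : probability (measurableTypeR R) R,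
    forall X, measurable X ->
      P X = (\int[lebesgue_measure]_(v in X `&` `[0%R, 1%R]) (f v)%:E)%E.
Proof. by exists density_law => X _; exact: density_lawE. Qed.

End DensityLaw.

Lemma exists_regular_distribution (R : realType) (f : R -> R) (c C : R) :
  0 < c -> (forall v, v \in `[0, 1] -> c <= f v <= C) ->
  measurable_fun (`[0, 1] : set R) f -> unit_integral f = 1 ->
  exists F : regular_distribution R, regular_density (law F) f.
Proof.
move=> c0 fC mf f1.
have f0 v : v \in `[0, 1] -> 0 <= f v.
  by move=> /fC /andP[cf _]; rewrite (le_trans (ltW c0)).
have fi : unit_integrable f.
  apply: (@unit_integrable_ae_bounded _ _ C) => //; apply: ae_unitW => v vI.
  by rewrite ger0_norm ?f0//; have /andP[] := fC v vI.
have [P PE] := exists_law_of_density mf f0 fi f1.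
suff H : regular_density P f by exists (RegularDistribution (ex_intro _ f H)).
split=> //.
- apply: (@lt_le_trans _ _ c%:E); first by rewrite lte_fin.
  by apply: le_ereal_inf_tmp => _ [v vI <-]; rewrite lee_fin; have /andP[] := fC v vI.
- apply: (@le_lt_trans _ _ C%:E); last exact: ltry.
  by apply: ge_ereal_sup => _ [v vI <-]; rewrite lee_fin; have /andP[] := fC v vI.
Qed.

Lemma regular_density_total (R : realType) (P : probability (measurableTypeR R) R)
    (f : R -> R) : regular_density P f -> unit_integral f = 1.
Proof.
move=> [_ _ _ fE]; have := fE setT measurableT; rewrite setTI probability_setT => H.
by rewrite /unit_integral /Rintegral -H.
Qed.

(** * Convergence of distributions and mixtures *)

Section WeakTopology.
Context (R : realType).
Implicit Types (F G K : regular_distribution R) (phi : test_function R).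

(** Two initial topologies are unfolded: the weak one, induced by [expectations], and the pointwise
    one, induced by evaluation at each test function. *)
Lemma cvg_regular_distribution (T : Type) (E : set_system T) (G : T -> regular_distribution R) F :
  Filter E -> (forall phi, expectations (G t) phi @[t --> E] --> expectations F phi) ->
  G t @[t --> E] --> F.
Proof.
move=> FE GF A /= [_ [[B Bop <-] BF sub]].
suff H : (@expectations R \o G) t @[t --> E] --> (expectations F : {ptws test_function R -> R}).
  have nB : nbhs (expectations F : {ptws test_function R -> R}) B.
    by apply: open_nbhs_nbhs.
  change (E (G @^-1` A)); have HB : E ((expectations (R:=R) \o G) @^-1` B) := H B nB.
  by apply: filterS HB => t; exact: sub.
apply/cvg_sup => phi D /= [_ [[D' D'op <-] D'F sub']].
have nD : nbhs (expectations F phi) D' by exact: open_nbhs_nbhs.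
have HD : E ((fun t => expectations (G t) phi) @^-1` D') := GF phi D' nD.
change (E ((@expectations R \o G) @^-1` D)).
by apply: filterS HD => t; exact: sub'.
Qed.

Lemma continuous_expectations phi :
  continuous (fun F : regular_distribution R => expectations F phi).
Proof.
move=> F A nA.
have H : nbhs (expectations F : {ptws test_function R -> R})
    [set g : {ptws test_function R -> R} | A (g phi)].
  have : nbhs (expectations F : {ptws test_function R -> R})
      --> (expectations F : {ptws test_function R -> R}) by exact: cvg_id.
  move=> /cvg_sup /(_ phi) /=; apply.
  by have := @initial_continuous _ _
    (fun f : (test_function R -> R) => f phi) (expectations F) A nA.
by have := @initial_continuous _ _ (@expectations R) F _ H.
Qed.

Lemma mix_regular_distribution F K (f k : R -> R) (t : R) : 0 <= t <= 1 ->
  regular_density (law F) f -> regular_density (law K) k ->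
  exists G, regular_density (law G) (fun v => (1 - t) * f v + t * k v).
Proof.
move=> /andP[t0 t1] ff kk.
have [c [C [c0 fC]]] := regular_density_bounds ff.
have [d [D [d0 kD]]] := regular_density_bounds kk.
have [mf _ _ _] := ff; have [mk _ _ _] := kk.
have int (h : R -> R) (a b : R) : 0 < a -> (forall v, v \in `[0, 1] -> a <= h v <= b) ->
    measurable_fun (`[0, 1] : set R) h -> unit_integrable h.
  move=> a0 hb mh; apply: (@unit_integrable_ae_bounded _ _ b) => //.
  apply: ae_unitW => v vI; have /andP[ah hle] := hb v vI.
  by rewrite ger0_norm// (le_trans (ltW a0)).
have fi := int _ _ _ c0 fC mf; have ki := int _ _ _ d0 kD mk.
apply: (@exists_regular_distribution R _ ((1 - t) * c + t * d) ((1 - t) * C + t * D)).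
- have [->|t_neq1] := eqVneq t 1; first by rewrite subrr mul0r add0r mul1r.
  have : 0 < 1 - t by rewrite subr_gt0 lt_neqAle t_neq1.
  by nra.
- move=> v vI; have /andP[cf fle] := fC v vI; have /andP[dk kle] := kD v vI.
  by rewrite !lerD// ler_wpM2l// subr_ge0.
- by measurability.
- rewrite unit_integralD ?unit_integralZ ?(regular_density_total ff)
    ?(regular_density_total kk)//; [|exact: unit_integrableZ..].
  by ring.
Qed.

(** Expectations under the mixture are affine in [t], so the mixtures converge to [F] as [t]
    decreases to 0. The strict bound [0 < t] makes later decreases strict. *)
Lemma mix_near F K (f k : R -> R) (W : set (regular_distribution R)) :
  regular_density (law F) f -> regular_density (law K) k -> nbhs F W ->
  exists t G, [/\ 0 < t <= 1, W G &
    regular_density (law G) (fun v => (1 - t) * f v + t * k v)].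
Proof.
move=> ff kk WF.
(* For [t] outside the unit interval the value is arbitrary and [F] serves as default, which gives a
   total function of [t]. *)
have mixP (t : R) : exists G, 0 <= t <= 1 ->
    regular_density (law G) (fun v => (1 - t) * f v + t * k v).
  have [t01|?] := boolP (0 <= t <= 1); last by exists F.
  by have [G GP] := mix_regular_distribution t01 ff kk; exists G.
pose G t := sval (cid (mixP t)).
have GP t : 0 <= t <= 1 ->
    regular_density (law (G t)) (fun v => (1 - t) * f v + t * k v).
  exact: (svalP (cid (mixP t))).
have [c [C [c0 fC]]] := regular_density_bounds ff.
have [d [D [d0 kD]]] := regular_density_bounds kk.
have [mf _ _ _] := ff; have [mk _ _ _] := kk.
have near01 : \forall t \near (0 : R)^'+, 0 < t <= 1.
  near=> t; apply/andP; split; near: t; first exact: nbhs_right_gt.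
  by apply: nbhs_right_le; exact: ltr01.
have GF : G t @[t --> (0 : R)^'+] --> F.
  apply: cvg_regular_distribution => phi.
  have fi : unit_integrable (fun v => sval phi v * f v).
    apply: (@unit_integrable_test _ _ _ C) => // v vI.
    by have /andP[cf ->] := fC v vI; rewrite (lt_le_trans c0).
  have ki : unit_integrable (fun v => sval phi v * k v).
    apply: (@unit_integrable_test _ _ _ D) => // v vI.
    by have /andP[dk ->] := kD v vI; rewrite (lt_le_trans d0).
  have E t : 0 < t <= 1 -> expectations (G t) phi =
      (1 - t) * expectations F phi + t * expectations K phi.
    move=> /andP[t0 t1]; rewrite (expectationsE phi ff) (expectationsE phi kk).
    rewrite -!unit_integralZ// -unit_integralD; [|exact: unit_integrableZ..].
    have t01 : 0 <= t <= 1 by rewrite ltW.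
    rewrite (expectationsE phi (GP t t01)).
    by apply: unit_integral_eq => v _; ring.
  have : (1 - t) * expectations F phi + t * expectations K phi @[t --> (0 : R)^'+] -->
      (1 - 0) * expectations F phi + 0 * expectations K phi.
    apply: cvg_at_right_filter; apply: cvgD; apply: cvgMl.
      by apply: cvgB; [exact: cvg_cst|exact: cvg_id].
    exact: cvg_id.
  rewrite subr0 mul1r mul0r addr0; apply: cvg_trans; apply: near_eq_cvg.
  by apply: filterS near01 => t t01; rewrite E.
have [t [t01 Wt]] : exists t, 0 < t <= 1 /\ W (G t).
  have GW : \forall t \near (0 : R)^'+, W (G t) := GF W WF.
  have H : \forall t \near (0 : R)^'+, 0 < t <= 1 /\ W (G t).
    by apply: filterS2 near01 GW => t; split.
  exact: filter_ex H.
exists t, (G t); split=> //; apply: GP; move/andP: t01 => [t0 ->]; by rewrite ltW.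
Unshelve. all: by end_near. Qed.

End WeakTopology.

(** * Genericity *)

Lemma regular_density_bounded (R : realType) (P : probability (measurableTypeR R) R)
    (f : R -> R) : regular_density P f ->
  exists C, forall v, v \in `[0, 1] -> 0 < f v <= C.
Proof.
move=> /regular_density_bounds[c [C [c0 fC]]]; exists C => v vI.
by have /andP[cf ->] := fC v vI; rewrite (lt_le_trans c0 cf).
Qed.

Lemma regular_density_measurable (R : realType) (P : probability (measurableTypeR R) R)
    (f : R -> R) : regular_density P f -> measurable_fun (`[0, 1] : set R) f.
Proof. by case. Qed.

(* [phi] and [psi] bracket the discontinuous function v 1_(v <= w), so that the
   condition is weak-* open as it stands. *)
Definition unbalanced (R : realType) (a b : R) (F G : regular_distribution R) : Prop :=
  exists w (phi psi pi : test_function R),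
    [/\ forall v, v \in `[0, 1] -> sval pi v = Num.max (v - w) 0,
        forall v, v \in `[0, 1] -> (if v <= w then v else 0) <= sval phi v,
        forall v, v \in `[0, 1] -> sval psi v <= (if v <= w then v else 0),
        a * expectations F phi < b * expectations G pi &
        a * expectations F pi < b * expectations G psi].

(** * Unbalanced pairs: openness, absence of roots, sufficient condition *)

Section Unbalanced.
Context (R : realType).
Implicit Types (F G K : regular_distribution R) (f g k : R -> R) (a b w x : R).

(** With [w] and the test functions fixed, two strict inequalities between continuous functions of
    [y] remain. The maps [u] and [u'] stand for the projections of a pair, in either order. *)
Lemma near_unbalanced (T : topologicalType) (u u' : T -> regular_distribution R) a b (x : T) :
  {for x, continuous u} -> {for x, continuous u'} -> unbalanced a b (u x) (u' x) ->
  \forall y \near x, unbalanced a b (u y) (u' y).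
Proof.
move=> cu cu' [w [phi [psi [pi [piE phiE psiE lt1 lt2]]]]].
have cE (z : T -> regular_distribution R) (h : test_function R) : {for x, continuous z} ->
    expectations (z y) h @[y --> x] --> expectations (z x) h.
  by move=> cz A nA; exact: (cz _ (@continuous_expectations R h (z x) A nA)).
have near_lt (h k : test_function R) :
    a * expectations (u x) h < b * expectations (u' x) k ->
    \forall y \near x, a * expectations (u y) h < b * expectations (u' y) k.
  move=> lt.
  have : b * expectations (u' y) k - a * expectations (u y) h @[y --> x] -->
      b * expectations (u' x) k - a * expectations (u x) h.
    by apply: cvgB; apply: cvgMr; exact: cE.
  move=> /cvgr_gt /(_ 0); rewrite subr_gt0 => /(_ lt).
  by apply: filterS => y; rewrite subr_gt0.
apply: filterS2 (near_lt _ _ lt1) (near_lt _ _ lt2) => y l1 l2.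
by exists w, phi, psi, pi.
Qed.

Lemma expectations_low_le F f w (phi : test_function R) : regular_density (law F) f ->
  (forall v, v \in `[0, 1] -> (if v <= w then v else 0) <= sval phi v) ->
  low_value f w <= expectations F phi.
Proof.
move=> ff H; rewrite (expectationsE phi ff).
have [C fC] := regular_density_bounded ff; have mf := regular_density_measurable ff.
apply: le_unit_integral; [exact: (@unit_integrable_low_value R f C mf fC)|
  exact: (@unit_integrable_test R phi f C mf fC)|].
apply: ae_unitW => v vI; rewrite ler_wpM2r ?H//.
by have /andP[/ltW] := fC v vI.
Qed.

Lemma expectations_low_ge F f w (phi : test_function R) : regular_density (law F) f ->
  (forall v, v \in `[0, 1] -> sval phi v <= (if v <= w then v else 0)) ->
  expectations F phi <= low_value f w.
Proof.
move=> ff H; rewrite (expectationsE phi ff).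
have [C fC] := regular_density_bounded ff; have mf := regular_density_measurable ff.
apply: le_unit_integral; [exact: (@unit_integrable_test R phi f C mf fC)|
  exact: (@unit_integrable_low_value R f C mf fC)|].
apply: ae_unitW => v vI; rewrite ler_wpM2r ?H//.
by have /andP[/ltW] := fC v vI.
Qed.

Lemma expectations_surplus F f w (pi : test_function R) : regular_density (law F) f ->
  (forall v, v \in `[0, 1] -> sval pi v = Num.max (v - w) 0) ->
  expectations F pi = surplus f w.
Proof.
by move=> ff H; rewrite (expectationsE pi ff); apply: unit_integral_eq => v vI; rewrite H.
Qed.

(** By monotonicity, the first equation fails strictly at every [x] up to [w], and the second at
    every [x] from [w] on. *)
Lemma unbalanced_no_equation F G f g a b x : 0 <= a -> 0 <= b ->
  regular_density (law F) f -> regular_density (law G) g -> unbalanced a b F G ->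
  a * low_value f x = b * surplus g x -> b * low_value g x = a * surplus f x -> False.
Proof.
move=> a0 b0 ff gg [w [phi [psi [pi [piE phiE psiE]]]]].
rewrite (expectations_surplus gg piE) (expectations_surplus ff piE) => lt1 lt2 e1 e2.
have [C fC] := regular_density_bounded ff; have mf := regular_density_measurable ff.
have [D gD] := regular_density_bounded gg; have mg := regular_density_measurable gg.
have := ler_wpM2l a0 (expectations_low_le ff phiE).
have := ler_wpM2l b0 (expectations_low_ge gg psiE) => l2 l1.
case: (leP x w) => [xw|/ltW wx].
  have := ler_wpM2l a0 (le_low_value mf fC xw).
  have := ler_wpM2l b0 (ge_surplus mg gD xw); lra.
have := ler_wpM2l b0 (le_low_value mg gD wx).
have := ler_wpM2l a0 (ge_surplus mf fC wx); lra.
Qed.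

Definition test_of (h : R -> R) (ch : continuous h) : test_function R :=
  exist _ h (continuous_subspaceT ch).

(** A continuous version of [v] cut off at [w]: the factor is 1 up to [w] and falls linearly to 0 at
    [w + e]. *)
Definition ramp w e (v : R) : R := v * Num.min 1 (Num.max 0 (1 - (v - w) / e)).

Lemma continuous_ramp w e : continuous (ramp w e).
Proof.
move=> v; apply: cvgM; first exact: cvg_id.
apply: (@continuous_min R R (cst 1) (fun v => Num.max 0 (1 - (v - w) / e)) v).
  exact: cvg_cst.
apply: (@continuous_max R R (cst 0) (fun v => 1 - (v - w) / e) v).
  exact: cvg_cst.
apply: cvgB; first exact: cvg_cst.
apply: cvgMl; apply: cvgB; [exact: cvg_id|exact: cvg_cst].
Qed.

Lemma continuous_excess w : continuous (fun v : R => Num.max (v - w) 0).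
Proof.
move=> v; apply: (@continuous_max R R (fun v => v - w) (cst 0) v); last exact: cvg_cst.
by apply: cvgB; [exact: cvg_id|exact: cvg_cst].
Qed.

Lemma ramp_bounds w e v : 0 < e -> v \in `[0, 1] ->
  (if v <= w then v else 0) <= ramp w e v <= (if v <= w + e then v else 0).
Proof.
move=> e0; rewrite in_itv/= => /andP[v0 v1]; rewrite /ramp.
set m := Num.min 1 _.
have m0 : 0 <= m by rewrite le_min ler01 le_max lexx.
have m1 : m <= 1 by rewrite ge_min lexx.
have -> : (if v <= w then v else 0) <= v * m.
  case: ifP => vw; last exact: mulr_ge0.
  suff -> : m = 1 by rewrite mulr1.
  rewrite /m min_l// le_max; apply/orP; right.
  by rewrite lerBrDl gerDr pmulr_lle0 ?invr_gt0// subr_le0.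
case: ifP => [_|/negbT]; first by rewrite ler_piMr.
rewrite -ltNge => vwe; suff -> : m = 0 by rewrite mulr0 lexx.
rewrite /m max_l ?min_r ?ler01// subr_le0 ler_pdivlMr// mul1r; lra.
Qed.

Lemma exists_unbalanced F G f g a b w : 0 < a -> 0 < b ->
  regular_density (law F) f -> regular_density (law G) g ->
  a * low_value f w < b * surplus g w -> a * surplus f w < b * low_value g w ->
  unbalanced a b F G.
Proof.
move=> a0 b0 ff gg lt1 lt2.
have [C fC] := regular_density_bounded ff; have mf := regular_density_measurable ff.
have [D gD] := regular_density_bounded gg; have mg := regular_density_measurable gg.
have I0 : (0 : R) \in `[0, 1] by rewrite in_itv/= lexx ler01.
have C0 : 0 < C by have /andP[] := fC 0 I0; exact: lt_le_trans.
have D0 : 0 < D by have /andP[] := gD 0 I0; exact: lt_le_trans.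
(* By the Lipschitz bounds, moving the cutoff up by [e1] or down by [e2] uses at most half of the
   corresponding gap. *)
pose e1 := (b * surplus g w - a * low_value f w) / (2 * (a * C)).
pose e2 := (b * low_value g w - a * surplus f w) / (2 * (b * D)).
have e10 : 0 < e1 by rewrite divr_gt0 ?mulr_gt0 ?subr_gt0.
have e20 : 0 < e2 by rewrite divr_gt0 ?mulr_gt0 ?subr_gt0.
exists w, (test_of (@continuous_ramp w e1)), (test_of (@continuous_ramp (w - e2) e2)),
  (test_of (@continuous_excess w)).
split=> //=.
- by move=> v vI; have /andP[] := ramp_bounds w e10 vI.
- by move=> v vI; have /andP[_] := ramp_bounds (w - e2) e20 vI; rewrite subrK.
- rewrite (expectations_surplus (w := w) gg)//.
  have H : expectations F (test_of (@continuous_ramp w e1)) <= low_value f (w + e1).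
    by apply: expectations_low_ge => // v vI; have /andP[] := ramp_bounds w e10 vI.
  have w_le : w <= w + e1 by rewrite lerDl ltW.
  have := low_value_lipschitz mf fC w_le; rewrite (addrC w) addrK => L.
  have E : a * (C * e1) = (b * surplus g w - a * low_value f w) / 2.
    by rewrite /e1; field; rewrite !gt_eqF.
  have := ler_wpM2l (ltW a0) H; have := ler_wpM2l (ltW a0) L.
  by rewrite mulrBr E (addrC w); lra.
- rewrite (expectations_surplus (w := w) ff)//.
  have H : low_value g (w - e2) <= expectations G (test_of (@continuous_ramp (w - e2) e2)).
    by apply: expectations_low_le => // v vI; have /andP[] := ramp_bounds (w - e2) e20 vI.
  have w_le : w - e2 <= w by rewrite gerBl ltW.
  have := low_value_lipschitz mg gD w_le; rewrite subKr => L.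
  have E : b * (D * e2) = (b * low_value g w - a * surplus f w) / 2.
    by rewrite /e2; field; rewrite !gt_eqF.
  have := ler_wpM2l (ltW b0) H; have := ler_wpM2l (ltW b0) L; rewrite mulrBr E; lra.
Qed.

End Unbalanced.

(** * Perturbing a distribution towards 0 *)

Section Perturbation.
Context (R : realType).
Implicit Types (F G K : regular_distribution R) (f g k : R -> R) (w : R).

(** The density is a floor [d], which keeps it regular, plus mass [1 - d] spread over the types up
    to [d]. Each part contributes at most [d] to the mean, and the mean bounds both quantities. *)
Lemma exists_concentrated_near0 (d : R) : 0 < d -> d < 1 ->
  exists K k, regular_density (law K) k /\
    forall w, 0 <= w -> low_value k w <= 2 * d /\ surplus k w <= 2 * d.
Proof.
move=> d0 d1; pose ind (v : R) : R := if 0 < v <= d then 1 else 0.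
have iind : unit_integrable ind by exact: unit_integrable_indicator.
have ind0 v : 0 <= ind v by rewrite /ind; case: ifP.
have ind1 v : ind v <= 1 by rewrite /ind; case: ifP.
pose s := unit_integral ind.
have s0 : 0 < s.
  rewrite ltNge; apply/negP => le0.
  have H : ae_unit (fun v => ind v = 0) by apply: unit_integral_eq0 => //; exact: ae_unitW.
  have [v _ [/andP[v0 vd]]] := ae_unit_exists (lexx 0) d0 ltr01 H.
  by rewrite /ind v0 (ltW vd)/= => /eqP; rewrite oner_eq0.
pose c := (1 - d) / s.
have c0 : 0 < c by rewrite divr_gt0// subr_gt0.
pose k v := d + c * ind v.
have mk : measurable_fun (`[0, 1] : set R) k.
  have mind := unit_integrable_measurable iind.
  by rewrite /k; measurability.
have k1 : unit_integral k = 1.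
  rewrite unit_integralD ?unit_integral_cst ?unit_integralZ//; last first.
  - exact: unit_integrableZ.
  - exact: unit_integrable_cst.
  by rewrite -/s /c divfK ?gt_eqF// subrKC.
have k_bounds v : v \in `[0, 1] -> d <= k v <= d + c.
  by move=> _; rewrite lerDl mulr_ge0 ?(ltW c0)//= lerD2l ler_piMr ?(ltW c0).
have k_gt0 v : v \in `[0, 1] -> 0 < k v <= d + c.
  by move=> /k_bounds /andP[dk ->]; rewrite (lt_le_trans d0 dk).
have [K kK] := exists_regular_distribution d0 k_bounds mk k1.
exists K, k; split=> // w w0.
have irhs : unit_integrable (fun v => d + c * d * ind v).
  by apply: unit_integrableD; [exact: unit_integrable_cst|exact: unit_integrableZ].
have rhs_le : unit_integral (fun v => d + c * d * ind v) <= 2 * d.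
  rewrite unit_integralD ?unit_integral_cst ?unit_integralZ//; last first.
  - exact: unit_integrableZ.
  - exact: unit_integrable_cst.
  have -> : c * d * s = (1 - d) * d by rewrite /c; field; rewrite gt_eqF.
  by nra.
have mean_le v : v \in `[0, 1] -> v * k v <= d + c * d * ind v.
  rewrite in_itv/= => /andP[v0 v1]; rewrite /k mulrDr lerD//.
    by rewrite ler_piMl// ltW.
  rewrite mulrCA -mulrA ler_wpM2l ?(ltW c0)//.
  by rewrite /ind; case: ifP => [/andP[_ vd]|_]; rewrite ?mulr0 ?mulr1.
split; apply: le_trans rhs_le; apply: le_unit_integral => //.
- exact: unit_integrable_low_value mk k_gt0 _.
- apply: ae_unitW => v vI; apply: le_trans (mean_le v vI).
  have /andP[/ltW kv0 _] := k_gt0 v vI; rewrite ler_wpM2r//; case: ifP => // _.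
  by move: vI; rewrite in_itv/= => /andP[].
- exact: unit_integrable_surplus_density mk k_gt0 _.
- apply: ae_unitW => v vI; apply: le_trans (mean_le v vI).
  have /andP[/ltW kv0 _] := k_gt0 v vI; rewrite ler_wpM2r// ge_max.
  by move: vI; rewrite in_itv/= => /andP[v0 _]; rewrite v0 andbT gerBl.
Qed.

(** Both quantities are affine in the density, so mixing in any positive share of a law for which
    both are smaller lowers both strictly. *)
Lemma exists_lower_nearby F f w (W : set (regular_distribution R)) :
  0 < w -> w < 1 -> regular_density (law F) f -> nbhs F W ->
  exists G g, [/\ W G, regular_density (law G) g,
    low_value g w < low_value f w & surplus g w < surplus f w].
Proof.
move=> w0 w1 ff WF.
have [C fC] := regular_density_bounded ff; have mf := regular_density_measurable ff.
have L0 := low_value_gt0 mf fC w0; have S0 := surplus_gt0 mf fC (ltW w0) w1.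
(* Then [2 * d] is at most half of either quantity, and [d < 1]. *)
pose d := Num.min (1 / 2) (Num.min (low_value f w) (surplus f w) / 4).
have d0 : 0 < d by rewrite lt_min !divr_gt0// lt_min L0 S0.
have d1 : d < 1 by rewrite gt_min; apply/orP; left; lra.
have dL : 2 * d < low_value f w.
  have : d <= low_value f w / 4.
    by rewrite ge_min; apply/orP; right; rewrite ler_pM2r ?invr_gt0// ge_min lexx.
  by lra.
have dS : 2 * d < surplus f w.
  have : d <= surplus f w / 4.
    by rewrite ge_min; apply/orP; right; rewrite ler_pM2r ?invr_gt0// ge_min lexx orbT.
  by lra.
have [K [k [kk kP]]] := exists_concentrated_near0 d0 d1.
have [kL kS] := kP w (ltW w0).
have [D kD] := regular_density_bounded kk; have mk := regular_density_measurable kk.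
have [t [G [/andP[t0 t1] WG gg]]] := mix_near ff kk WF.
exists G, (fun v => (1 - t) * f v + t * k v).
have mix (h : R -> R) : unit_integrable (fun v => h v * f v) ->
    unit_integrable (fun v => h v * k v) ->
    unit_integral (fun v => h v * ((1 - t) * f v + t * k v)) =
    (1 - t) * unit_integral (fun v => h v * f v) + t * unit_integral (fun v => h v * k v).
  move=> i1 i2; rewrite -!unit_integralZ// -unit_integralD; [|exact: unit_integrableZ..].
  by apply: unit_integral_eq => v _; ring.
split=> //.
- rewrite /low_value mix; [|exact: unit_integrable_low_value mf fC _|
    exact: unit_integrable_low_value mk kD _].
  by rewrite -!/(low_value _ _); nra.
- rewrite /surplus mix; [|exact: unit_integrable_surplus_density mf fC _|
    exact: unit_integrable_surplus_density mk kD _].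
  by rewrite -!/(surplus _ _); nra.
Qed.

(** Intermediate values: the difference of the two sides is continuous in [w], negative at 0, where
    no low value exists, and positive at 1, where no surplus is left. *)
Lemma exists_balanced_wage F G f g (a : R) : 0 < a ->
  regular_density (law F) f -> regular_density (law G) g ->
  exists w, [/\ 0 < w, w < 1 & a * low_value f w = surplus g w].
Proof.
move=> a0 ff gg.
have [C fC] := regular_density_bounded ff; have mf := regular_density_measurable ff.
have [D gD] := regular_density_bounded gg; have mg := regular_density_measurable gg.
have I0 : (0 : R) \in `[0, 1] by rewrite in_itv/= lexx ler01.
have C0 : 0 < C by have /andP[] := fC 0 I0; exact: lt_le_trans.
have D0 : 0 < D by have /andP[] := gD 0 I0; exact: lt_le_trans.
pose h w := a * low_value f w - surplus g w.
have ch : continuous h.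
  apply: (@lipschitz_continuous _ _ (a * C + D)) => [|x y xy].
    by rewrite addr_ge0 ?mulr_ge0 ?ltW.
  have L0 := le_low_value mf fC xy; have S0 := ge_surplus mg gD xy.
  have L := low_value_lipschitz mf fC xy; have S := surplus_lipschitz mg gD xy.
  have aL := ler_wpM2l (ltW a0) L; have aL0 := ler_wpM2l (ltW a0) L0.
  by rewrite /h ger0_norm; lra.
have h0 : h 0 < 0 by rewrite /h low_value0 mulr0 sub0r oppr_lt0 (surplus_gt0 mg gD).
have h1 : 0 < h 1 by rewrite /h surplus1 subr0 mulr_gt0// (low_value_gt0 mf fC).
have [|w wI hw] := @IVT R h 0 1 0 ler01 (continuous_subspaceT ch).
  by rewrite ge_min le_max (ltW h0) (ltW h1) orbT.
move: wI; rewrite in_itv/= => /andP[w0 w1]; exists w; split.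
- by rewrite lt_neqAle w0 andbT; apply/eqP => w00; rewrite -w00 in hw; rewrite hw ltxx in h0.
- by rewrite lt_neqAle w1 andbT; apply/eqP => w11; rewrite w11 in hw; rewrite hw ltxx in h1.
- by apply/eqP; rewrite -subr_eq0 -/(h w) hw.
Qed.

End Perturbation.

(** * The open dense set of pairs without a common root *)

Theorem proposition2 (R : realType) (beta : R) (hbeta : 1 <= beta) :
  generically (fun FA FB : regular_distribution R =>
    forall f : worker_group -> R -> R,
      regular_density (law FA) (f GroupA) ->
      regular_density (law FB) (f GroupB) ->
      forall O : firm -> firm_outcome R,
        core_outcome beta f O -> completely_segregated f O).
Proof.
have beta0 : 0 < beta by exact: lt_le_trans hbeta.
pose U : set (regular_distribution R * regular_distribution R) :=
  [set p | unbalanced beta 1 p.1 p.2 \/ unbalanced 1 beta p.2 p.1].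
exists U; split.
- rewrite openE => p Up; change (nbhs p U).
  pose D := regular_distribution R.
  have c1 : {for p, continuous (fst : D * D -> D)} by exact: cvg_fst.
  have c2 : {for p, continuous (snd : D * D -> D)} by exact: cvg_snd.
  case: Up => [/(near_unbalanced c1 c2)|/(near_unbalanced c2 c1)].
    by apply: filterS => q; left.
  by apply: filterS => q; right.
- move=> Q [[FA FB] QF] Qopen.
  have : nbhs (FA, FB) Q by exact: open_nbhs_nbhs.
  move=> [[QA QB] /= [QAF QBF] sub].
  have [fA ffA] := law_regular FA; have [fB ffB] := law_regular FB.
  have [w [w0 w1 wE]] := exists_balanced_wage beta0 ffA ffB.
  (* At the root [w] of the first equation, the second holds or fails in a known direction. Lowering
     both values of one group makes the first fail strictly and pushes the second further: group A
     in the first case, group B in the second. *)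
  case: (leP (beta * surplus fA w) (low_value fB w)) => le.
    have [G [g [QG gg lowG surG]]] := exists_lower_nearby w0 w1 ffA QAF.
    exists (G, FB); split.
      by apply: sub; split => //=; exact: nbhs_singleton QBF.
    left; apply: (exists_unbalanced (w := w) beta0 ltr01 gg ffB); rewrite mul1r.
      by rewrite -wE ltr_pM2l.
    by apply: lt_le_trans le; rewrite ltr_pM2l.
  have [G [g [QG gg lowG surG]]] := exists_lower_nearby w0 w1 ffB QBF.
  exists (FA, G); split.
    by apply: sub; split => //=; exact: nbhs_singleton QAF.
  right; apply: (exists_unbalanced (w := w) ltr01 beta0 gg ffA); rewrite mul1r.
    exact: lt_trans le.
  by rewrite wE.
(* A core outcome that is not segregated would provide a common root, which unbalanced pairs
   exclude. *)
- move=> FA FB unb f fA fB O coreO; apply: contrapT => nseg.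
  have [CA fCA] := regular_density_bounded fA; have [CB fCB] := regular_density_bounded fB.
  have mf g : measurable_fun (`[0, 1] : set R) (f g).
    by case: g; [exact: regular_density_measurable fA|exact: regular_density_measurable fB].
  have f_gt0 g v : v \in `[0, 1] -> 0 < f g v.
    by case: g => vI; [have /andP[] := fCA v vI|have /andP[] := fCB v vI].
  have f_le g v : v \in `[0, 1] -> f g v <= Num.max CA CB.
    rewrite le_max; case: g => vI;
      [have /andP[_ ->] := fCA v vI|have /andP[_ ->] := fCB v vI] => //.
    by rewrite orbT.
  have [x [eA eB]] := core_equation hbeta mf f_gt0 f_le coreO nseg.
  case: unb => /= unb.
    by apply: (unbalanced_no_equation (x := x) (ltW beta0) ler01 fA fB unb); rewrite !mul1r.
  by apply: (unbalanced_no_equation (x := x) ler01 (ltW beta0) fB fA unb); rewrite !mul1r.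
Qed.
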